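(* Let $m'$ be a positive integer that is odd and not divisible by $3$ or $5$, and let $f:\mathbb{Z}_3^3\to\mathbb{Z}_{5m'}$ be a generalized bent function. Then for each nonzero $x\in\mathbb{Z}_3^3$, $E_x$ is not of the form $D_5g^{\alpha_x}+D_{11}(g^{\beta_x}+g^{\gamma_x})$ for any integers $\alpha_x,\beta_x,\gamma_x$. Moreover, $11\nmid k_x$ for every nonzero $x\in\mathbb{Z}_3^3$, where $k_x$ is the $c$-exponent of $E_x$.
   Context: A function $f:G\to\mathbb{Z}_m$ on a finite abelian group $G$ is a generalized bent function if $\left|\sum_{x\in G}\zeta_m^{f(x)}\chi(x)\right|^2=|G|$ for every character $\chi$ of $G$, where $\zeta_m$ is a primitive $m$-th root of unity. Here $m=5m'$, $C_m$ is the multiplicative cyclic group of order $m$ with generator $g$, and $E_x=\sum_{y\in\mathbb{Z}_3^3}g^{f(x+y)-f(y)}\in\mathbb{N}[C_m]$. For $d\mid m$, $D_d=\sum_{h\in H_d}h$ with $H_d$ the unique subgroup of $C_m$ of order $d$. An element $X=\sum a_ig^i\in\mathbb{N}[C_m]$ (nonnegative integer coefficients) is a $v$-sum if $\sum a_i\zeta_m^i=0$; it is a minimal $v$-sum if no nonzero $Y=\sum b_ig^i$ with $0\le b_i\le a_i$, $Y\ne X$, is a $v$-sum. The reduced exponent of a minimal $v$-sum $\sum a_ig^i$ is the smallest $r\ge1$ such that for some index $j$ with $a_j>0$, $(\zeta_m^{i-j})^r=1$ for all $i$ with $a_i>0$. For a decomposition of a $v$-sum $X$ into minimal $v$-sums,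 the associated reduced exponent is the lcm of those of the summands; the $c$-exponent of $X$ is the minimum of this over all such decompositions. (For a GBF, each $E_x$ with $x\ne0$ is a $v$-sum.) *)

(* Defs.v *)
From HB Require Import structures.
From mathcomp Require Import all_boot all_order all_algebra all_fingroup.
From mathcomp Require Import all_solvable all_field all_character.
From mathcomp Require Import boolp.

Set Implicit Arguments.
Unset Strict Implicit.
Unset Printing Implicit Defensive.

Import Order.TTheory GRing.Theory Num.Theory.
Local Open Scope ring_scope.

(* Least natural number satisfying [P]; the junk value is 0 when there is none. *)
Definition least_nat (P : nat -> Prop) : nat :=
  match pselect (exists n, `[< P n >]) with
  | left exP => ex_minn exP
  | right _ => 0%N
  end.

Lemma least_natP (P : nat -> Prop) :
  (exists n, P n) ->
  P (least_nat P) /\ (forall n, P n -> (least_nat P <= n)%N).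
Proof.
move=> [n Pn]; rewrite /least_nat; case: pselect => [exP|]; last first.
  by case; exists n; apply/asboolP.
case: ex_minnP => k /asboolP Pk kmin; split=> // l Pl.
by apply: kmin; apply/asboolP.
Qed.

(* The characters of the finite abelian group [G] are its linear characters,
   with values in the algebraic complex numbers. *)
Definition generalized_bent (G : finZmodType) (m : nat) (zeta : algC)
    (f : G -> 'Z_m) : Prop :=
  forall chi : 'CF([set: G]), chi \is a linear_char ->
    `| \sum_(x : G) zeta ^+ f x * chi x | ^+ 2 = #|G|%:R.

(* The group semiring N[gT]: [X h] is the coefficient of [h].  Addition is the
   pointwise one of {ffun gT -> nat}; the product is [nmul], not the pointwise
   product that {ffun gT -> nat} also carries. *)
Notation "'N[' gT ]" := {ffun gT -> nat} (format "'N[' gT ]").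

Section GroupSemiring.
Variable gT : finGroupType.
Implicit Types X Y : N[gT].

Definition nelt (h : gT) : N[gT] := [ffun u => (u == h) : nat].

Definition nmul X Y : N[gT] :=
  [ffun h => (\sum_(u : gT) X u * Y (u^-1 * h)%g)%N].

Definition nset (A : {set gT}) : N[gT] := \sum_(h in A) nelt h.

Definition expgz (h : gT) (a : int) : gT :=
  match a with
  | Posz n => (h ^+ n)%g
  | Negz n => (h ^- n.+1)%g
  end.
End GroupSemiring.

Section VanishingSums.
Variables (gT : finGroupType) (g : gT) (zeta : algC).
Implicit Types X Y : N[gT].

Definition vsum X : Prop :=
  \sum_(i < #[g]%g) (X (g ^+ i)%g)%:R * zeta ^+ i = 0.

Definition minimal_vsum X : Prop :=
  [/\ X <> 0, vsum X &
      forall Y, Y <> 0 -> (forall h, Y h <= X h)%N -> Y <> X -> ~ vsum Y].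

Definition reduced_exponent X : nat :=
  least_nat (fun r => (1 <= r)%N /\
    exists j : 'I_#[g]%g, (0 < X (g ^+ j)%g)%N /\
      forall i : 'I_#[g]%g, (0 < X (g ^+ i)%g)%N ->
        (zeta ^+ i / zeta ^+ j) ^+ r = 1).

Definition decomposition X (s : seq N[gT]) : Prop :=
  (forall Y, Y \in s -> minimal_vsum Y) /\ X = \sum_(Y <- s) Y.

Definition c_exponent X : nat :=
  least_nat (fun k => exists2 s, decomposition X s &
    k = \big[lcmn/1%N]_(Y <- s) reduced_exponent Y).
End VanishingSums.

Definition E_ (G : finZmodType) (m : nat) (gT : finGroupType) (g : gT)
    (f : G -> 'Z_m) (x : G) : N[gT] :=
  \sum_(y : G) nelt (g ^+ (f (x + y) - f y)%R)%g.

(* Main.v *)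
Require Import Defs.
From HB Require Import structures.
From mathcomp Require Import all_boot all_order all_algebra all_fingroup.
From mathcomp Require Import all_solvable all_field all_character.
From mathcomp Require Import zify ring.

Set Implicit Arguments.
Unset Strict Implicit.
Unset Printing Implicit Defensive.

Import Order.TTheory GRing.Theory Num.Theory.
Local Open Scope ring_scope.

(* A vanishing sum of at most 27 roots of unity of order prime to 6 is a sum of
   cosets of subgroups of prime order.  This follows by induction on the group:
   splitting off the largest prime q, Galois conjugation shows that the q
   components of the sum have the same value, and a component of minimal weight
   has to be repeated in all the others, which exhibits a coset of order q.
   Hence a minimal vanishing sum contributing the prime 11 is a coset of H_11,
   and since 27 - 11 = 5 + 11 is the only way to complete the weight, the second
   claim reduces to the first.

   For the first claim, the exponents f(x + y) - f(y) of E_x split into 9 zero-sum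
   triples, one for each orbit of x.  If E_x is made of cosets of H_5, H_11, H_11,
   weight functions on zero-sum triples force these exponents to be multiples of
   5, up to one coset of H_5, and to be killed by 55.  So 55 f is x-invariant;
   each value of 55 (f(y + z) - f(z)) is then taken at least 3 times, which leaves
   the type (5, 11, 11) as the only possibility for every E_y with y <> 0.
   Therefore f mod 5 has 27 + 26 * 23 = 625 coincidences on pairs of points, and
   625 is not a sum of squares of five numbers with sum 27. *)

(** * Vanishing sums of small weight *)

Section FaithfulCharacter.
Variables (gT : finGroupType) (phi : gT -> algC).
Hypotheses (cyc_gT : cyclic [set: gT]) (phi1 : phi 1%g = 1)
  (phiM : {morph phi : u v / (u * v)%g >-> u * v}) (phi_inj : injective phi).
Implicit Types (K L H : {group gT}) (D : gT -> int) (X Y Z : gT -> nat).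

Let mulgCT (u v : gT) : (u * v = v * u)%g.
Proof. by apply: (centsP (cyclic_abelian cyc_gT)); rewrite inE. Qed.

Let cyclicG K : cyclic K.
Proof. exact: cyclicS (subsetT K) cyc_gT. Qed.

Lemma chiX u k : phi (u ^+ k)%g = phi u ^+ k.
Proof. by elim: k => [|k IHk]; rewrite ?expg0 // expgS exprS phiM IHk. Qed.

Lemma chi_neq0 u : phi u != 0.
Proof.
apply/eqP=> u0; have := phi1; rewrite -(mulgV u) phiM u0 mul0r => /esym/eqP.
by rewrite oner_eq0.
Qed.

Lemma chi_geometric_sum q u :
  (u ^+ q)%g = 1%g -> \sum_(j < q) phi u ^+ j = (if u == 1%g then q%:R else 0).
Proof.
move=> uq1; case: eqP => [->|/eqP u1].
  by under eq_bigr do rewrite phi1 expr1n; rewrite sumr_const card_ord.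
have phiu1 : phi u - 1 != 0 by rewrite subr_eq0 -phi1 (inj_eq phi_inj).
by apply: (mulfI phiu1); rewrite mulr0 -subrX1 -chiX uq1 phi1 subrr.
Qed.

(** * Galois conjugation and the components of a sum over a subgroup *)

Definition chi_int_sum (A : {set gT}) D : algC := \sum_(u in A) (D u)%:~R * phi u.

Lemma chi_int_sum_galois K D k :
  coprime k #|K| -> chi_int_sum K D = 0 ->
  \sum_(u in K) (D u)%:~R * phi u ^+ k = 0.
Proof.
move=> cok; have [nu nuE] := Qn_aut_exists cok.
rewrite /chi_int_sum => /(congr1 nu); rewrite rmorph0 rmorph_sum /=.
move=> nu0; apply: etrans nu0; apply: eq_bigr => u Ku; rewrite rmorphM /= rmorph_int nuE //.
by rewrite -chiX expg_cardG.
Qed.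

(* Fourier inversion on the group of q-th roots of unity [phi (u ^+ e)] isolates
   the part of the sum lying over a single coset of [L]. *)
Lemma chi_coset_fourier K L D q e t :
  (forall u, u \in K -> (u ^+ e) ^+ q = 1)%g ->
  L :=: [set u in K | u ^+ e == 1]%g -> t \in K ->
  q%:R * (phi t * chi_int_sum L (fun u => D (t * u)%g)) =
  \sum_(j < q) phi (t ^- e)%g ^+ j *
     \sum_(u in K) (D u)%:~R * phi u ^+ (1 + j * e).
Proof.
move=> eq1 defL Kt; under [RHS]eq_bigr do rewrite mulr_sumr.
rewrite exchange_big /=.
have termE u : u \in K ->
    \sum_(j < q) phi (t ^- e)%g ^+ j * ((D u)%:~R * phi u ^+ (1 + j * e)) =
    (D u)%:~R * phi u * (if (u \in t *: L)%g then q%:R else 0).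
  move=> Ku; have Ktu : (t^-1 * u)%g \in K by rewrite groupM ?groupV.
  have -> : (u \in (t *: L)%g) = ((t^-1 * u) ^+ e == 1)%g.
    by rewrite mem_lcoset defL inE Ktu.
  rewrite -chi_geometric_sum; last exact: eq1.
  rewrite mulr_sumr; apply: eq_bigr => j _.
  rewrite expgMn; last exact: mulgCT.
  rewrite expgVn phiM exprMn exprD expr1 -(chiX u) mulnC expgM chiX.
  by rewrite mulrCA -!mulrA; congr (_ * _); rewrite mulrCA.
rewrite (eq_bigr _ termE) (bigID (fun u => u \in (t *: L)%g)) /=.
rewrite [X in _ = _ + X]big1 ?addr0; last first.
  by move=> u /andP[_ /negPf ->]; rewrite mulr0.
rewrite (eq_bigl (fun u => u \in (t *: L)%g)); last first.
  move=> u; apply: andb_idl; rewrite mem_lcoset defL inE => /andP[Ktu _].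
  by rewrite -(groupMl _ (groupVr Kt)).
rewrite (reindex_inj (mulgI t)) /= mulrA mulr_sumr.
rewrite [RHS](eq_bigl (fun u => u \in L)); last first.
  by move=> u /=; rewrite mem_lcoset mulKg.
apply: eq_bigr => u Lu; rewrite mem_lcoset mulKg Lu phiM.
by rewrite [RHS]mulrC -!mulrA; congr (_ * _); rewrite mulrCA.
Qed.

Lemma subgroup_of_card K d :
  (d %| #|K|)%N -> exists2 L : {group gT}, L \subset K & #|L| = d.
Proof.
move=> dK; have /cyclicP[k defK] := cyclicG K.
exists <[k ^+ (#|K| %/ d)]>%G; first by rewrite /= defK cycle_subG mem_cycle.
rewrite /= -/(order _) orderXdiv; last by rewrite orderE -defK dvdn_div.
by rewrite orderE -defK divnA // mulKn ?cardG_gt0.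
Qed.

Lemma mem_subgroup_expg K L u :
  L \subset K -> u \in K -> (u \in L) = (u ^+ #|L| == 1)%g.
Proof.
move=> sLK Ku; apply/idP/eqP => [|u1]; first exact: expg_cardG.
rewrite -cycle_subG -(cardSg_cyclic (cyclicG K)) ?cycle_subG //.
by rewrite order_dvdn u1.
Qed.

Lemma subgroup_expgE K L :
  L \subset K -> L :=: [set u in K | u ^+ #|L| == 1]%g.
Proof.
move=> sLK; apply/setP=> u; rewrite inE; case Ku: (u \in K) => /=.
  by rewrite (mem_subgroup_expg sLK).
by apply: contraFF Ku; apply/subsetP.
Qed.

(** With [#|K| = r q^2] and [e = r q], every [1 + j e] is coprime to [#|K|], so all conjugates in
    the Fourier inversion vanish. *)
Lemma chi_sum_square_part K q :
  prime q -> (q ^ 2 %| #|K|)%N ->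
  exists L : {group gT}, [/\ L \subset K, (#|L| * q)%N = #|K| &
    forall D, chi_int_sum K D = 0 ->
      forall t, t \in K -> chi_int_sum L (fun u => D (t * u)%g) = 0].
Proof.
move=> pr_q /dvdnP[r Kr]; have q0 := prime_gt0 pr_q.
have rqK : (r * q %| #|K|)%N by rewrite Kr dvdn_mul // expnS dvdn_mulr.
have [L sLK cL] := subgroup_of_card rqK.
exists L; split; rewrite // ?cL ?Kr ?mulnA // => D D0 t Kt.
apply: (mulfI (chi_neq0 t)); rewrite mulr0.
have q0C : q%:R != 0 :> algC by rewrite pnatr_eq0 -lt0n.
apply: (mulfI q0C); rewrite mulr0 (@chi_coset_fourier K L D q (r * q)) //.
- rewrite big1 // => j _; rewrite chi_int_sum_galois ?mulr0 // Kr.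
  rewrite coprimeMr coprimeXr /coprime addnC gcdnC.
    by rewrite (mulnC r) mulnA gcdnMDl gcdn1.
  by rewrite mulnA gcdnMDl gcdn1.
- by move=> u Ku; rewrite -expgM -mulnA mulnn -Kr expg_cardG.
- by rewrite -cL; apply: subgroup_expgE.
Qed.

(** [K] is the direct product of [H] and [L]; being 1 mod [q] and 0 mod [r], [e] makes [u ^+ e] the
    projection to [H]. Among the exponents [1 + j e] only [j = q - 1] is not coprime to [#|K|], and
    once [phi h] is cancelled the surviving term does not depend on [h]. *)
Lemma chi_sum_coprime_part K q r :
  prime q -> #|K| = (q * r)%N -> coprime q r ->
  exists L H : {group gT}, [/\ L \subset K, H \subset K, #|L| = r, #|H| = q &
    [/\ forall u, u \in K -> exists h l, [/\ h \in H, l \in L & u = (h * l)%g],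
    forall X, (\sum_(u in K) X u = \sum_(h in H) \sum_(l in L) X (h * l)%g)%N &
    forall D, chi_int_sum K D = 0 -> forall h h', h \in H -> h' \in H ->
      chi_int_sum L (fun u => D (h * u)%g) =
      chi_int_sum L (fun u => D (h' * u)%g)]].
Proof.
move=> pr_q cK coqr; have q0 := prime_gt0 pr_q.
have q0C : q%:R != 0 :> algC by rewrite pnatr_eq0 -lt0n.
have [L sLK cL] : exists2 L : {group gT}, L \subset K & #|L| = r.
  by apply: subgroup_of_card; rewrite cK dvdn_mull.
have [H sHK cH] : exists2 H : {group gT}, H \subset K & #|H| = q.
  by apply: subgroup_of_card; rewrite cK dvdn_mulr.
pose e := chinese q r 1 0.
have eq1 : (e = 1 %[mod q])%N by rewrite /e chinese_modl.
have er0 : (r %| e)%N by rewrite /dvdn /e chinese_modr ?mod0n.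
have He u : u \in H -> (u ^+ e = u)%g.
  move=> Hu; have := expg_cardG Hu; rewrite cH => uq.
  by rewrite (divn_eq e q) eq1 mulnC expgD expgM uq expg1n mul1g expg_mod.
have Ke u : u \in K -> (u ^+ e)%g \in H.
  move=> Ku; rewrite (mem_subgroup_expg sHK) ?groupX // cH -expgM.
  case/dvdnP: er0 => k ->; rewrite -mulnA (mulnC r) mulnC expgM -cK.
  by rewrite expg_cardG ?expg1n.
have defL : L :=: [set u in K | u ^+ e == 1]%g.
  rewrite [LHS](subgroup_expgE sLK) cL; apply/setP => u; rewrite !inE.
  case Ku: (u \in K) => //=; apply/eqP/eqP => u1.
    by case/dvdnP: er0 => k ->; rewrite mulnC expgM u1 expg1n.
  have Hu : (u ^+ r)%g \in H.
    by rewrite (mem_subgroup_expg sHK) ?groupX // cH -expgM mulnC -cK expg_cardG.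
  by rewrite -(He _ Hu) -expgM mulnC expgM u1 expg1n.
exists L, H; split=> //; split=> [u Ku|X|D D0].
- exists (u ^+ e)%g, ((u ^+ e)^-1 * u)%g; rewrite mulKVg Ke //; split=> //.
  have Hu := Ke u Ku; rewrite defL inE groupM ?groupV ?groupX //=.
  rewrite expgMn; last exact: mulgCT.
  by rewrite expgVn (He _ Hu) mulVg.
- rewrite (partition_big (fun u => u ^+ e)%g (mem H)) //=.
  apply: eq_bigr => h Hh; rewrite (reindex_inj (mulgI h)) /=.
  apply: eq_bigl => l; have Kh := subsetP sHK _ Hh.
  rewrite groupMl // defL inE expgMn; last exact: mulgCT.
  by rewrite (He h Hh) eq_sym eq_mulVg1 mulKg.
suffices main h : h \in H -> q%:R * chi_int_sum L (fun u => D (h * u)%g) =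
    \sum_(u in K) (D u)%:~R * phi u ^+ (1 + q.-1 * e).
  by move=> h h' Hh Hh'; apply: (mulfI q0C); rewrite !main.
move=> Hh; have Kh := subsetP sHK _ Hh; apply: (mulfI (chi_neq0 h)).
rewrite mulrCA (@chi_coset_fourier K L D q e) //; last first.
  by move=> u Ku; have := expg_cardG (Ke u Ku); rewrite cH.
rewrite He // -(prednK q0) big_ord_recr /= big1 ?add0r; last first.
  move=> j _; rewrite chi_int_sum_galois ?mulr0 // cK coprimeMr.
  apply/andP; split; last first.
    case/dvdnP: er0 => k ->; rewrite /coprime addnC gcdnC mulnA.
    by rewrite gcdnMDl gcdn1.
  rewrite coprime_sym prime_coprime // /dvdn -modnDmr -modnMmr eq1 modnMmr.
  rewrite muln1 modnDmr modn_small //; have := ltn_ord j; move: q0; clear; lia.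
congr (_ * _); rewrite -chiX -[in RHS](invgK h); congr phi.
by apply/eqP; rewrite eq_sym eq_invg_mul -expgS prednK // expgVn -cH expg_cardG ?invg1.
Qed.

(** * Coset-free sums are determined by their value *)

Definition chi_sum (A : {set gT}) X : algC := \sum_(u in A) (X u)%:R * phi u.
Definition weight (A : {set gT}) X : nat := (\sum_(u in A) X u)%N.

Definition coset_free K X := forall H a, H \subset K -> a \in K ->
  prime #|H| -> exists2 h, h \in H & X (a * h)%g = 0%N.

Definition translate t X : gT -> nat := fun u => X (t * u)%g.

Lemma chi_sumB A Y Z :
  chi_sum A Y - chi_sum A Z = chi_int_sum A (fun u => (Y u)%:Z - (Z u)%:Z).
Proof.
rewrite /chi_sum /chi_int_sum -sumrB; apply: eq_bigr => u _.
by rewrite rmorphB mulrBl.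
Qed.

Lemma chi_sumD A Y Z :
  chi_sum A (fun u => Y u + Z u)%N = chi_sum A Y + chi_sum A Z.
Proof.
by rewrite /chi_sum -big_split /=; apply: eq_bigr => u _; rewrite natrD mulrDl.
Qed.

Lemma weightD A Y Z : weight A (fun u => Y u + Z u)%N = (weight A Y + weight A Z)%N.
Proof. exact: big_split. Qed.

Lemma weight_eq0 A X : weight A X = 0%N -> {in A, forall u, X u = 0%N}.
Proof.
move=> /eqP; rewrite /weight sum_nat_eq0 => /forall_inP X0 u Au.
exact/eqP/X0.
Qed.

Lemma chi_sum_weight0 A X : weight A X = 0%N -> chi_sum A X = 0.
Proof. by move/weight_eq0=> X0; apply: big1 => u Au; rewrite X0 // mul0r. Qed.

Lemma coset_free_translate K L X t :
  L \subset K -> t \in K -> coset_free K X -> coset_free L (translate t X).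
Proof.
move=> sLK Kt fX H a sHL La pr_H.
have [|h Hh Xh] := fX H (t * a)%g (subset_trans sHL sLK) _ pr_H.
  by rewrite groupM // (subsetP sLK).
by exists h; rewrite // /translate mulgA.
Qed.

Lemma weight_coset K X H a n :
  H \subset K -> a \in K -> (forall h, h \in H -> n <= X (a * h)%g)%N ->
  (n * #|H| <= weight K X)%N.
Proof.
move=> sHK Ka Xn; rewrite /weight (reindex_inj (mulgI a)) /=.
under eq_bigl do rewrite groupMl //.
rewrite (big_setID H) /= (setIidPr sHK) mulnC -sum_nat_const.
by apply: leq_trans (leq_addr _ _); apply: leq_sum => h; apply: Xn.
Qed.

Lemma weight_translate_le K L X t :
  L \subset K -> t \in K -> (weight L (translate t X) <= weight K X)%N.
Proof.
move=> sLK Kt; rewrite /weight [leqRHS](reindex_inj (mulgI t)) /=.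
under [leqRHS]eq_bigl do rewrite groupMl //.
by rewrite [leqRHS](big_setID L) /= (setIidPr sLK) leq_addr.
Qed.

Lemma weight_coset_free K X :
  (forall H, H \subset K -> prime #|H| -> weight K X < #|H|)%N -> coset_free K X.
Proof.
move=> Xsmall H a sHK Ka pr_H; have := Xsmall H sHK pr_H.
have [/exists_inP[h Hh /eqP Xh] _|] := boolP [exists h in H, X (a * h)%g == 0%N].
  by exists h.
rewrite negb_exists_in => /forall_inP Xpos; rewrite ltnNge -(mul1n #|H|).
case/negP; apply: (@weight_coset K X H a) => // h /Xpos.
by rewrite lt0n.
Qed.

Lemma chi_sum_square_eq K q :
  prime q -> (q ^ 2 %| #|K|)%N ->
  exists L : {group gT}, [/\ L \subset K, (#|L| * q)%N = #|K| &
    forall Y Z, chi_sum K Y = chi_sum K Z ->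
      forall t, t \in K -> chi_sum L (translate t Y) = chi_sum L (translate t Z)].
Proof.
move=> pr_q qK; have [L [sLK cL vL]] := chi_sum_square_part pr_q qK.
exists L; split=> // Y Z /eqP; rewrite -subr_eq0 chi_sumB => /eqP YZ t Kt.
by apply/eqP; rewrite -subr_eq0 chi_sumB; apply/eqP/(vL _ YZ t Kt).
Qed.

Lemma chi_sum_trivial K Y Z :
  #|K| = 1%N -> chi_sum K Y = chi_sum K Z -> {in K, Y =1 Z}.
Proof.
move=> /card1_trivg K1; rewrite /chi_sum K1 !big_set1 phi1 !mulr1.
by move=> /eqP; rewrite eqr_nat => /eqP YZ u /set1P->.
Qed.

(** If [p^2] divides [#|K|], pass to the cosets of the subgroup of index [p]. If [#|K| = p], the
    difference [Y - Z] is constant; a zero of [Y] and a zero of [Z] force the constant to be 0. *)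
Lemma chi_sum_inj_pgroup p K Y Z :
  prime p -> (p.-group K)%g -> coset_free K Y -> coset_free K Z ->
  chi_sum K Y = chi_sum K Z -> {in K, Y =1 Z}.
Proof.
move=> pr_p; have [n] := ubnP #|K|; elim: n => // n IHn in K Y Z *.
rewrite ltnS => leKn pK fY fZ eqYZ.
have [pp|p_sq] := boolP (p ^ 2 %| #|K|)%N.
  have [L [sLK cL /(_ _ _ eqYZ) vL]] := chi_sum_square_eq pr_p pp.
  move=> t Kt; rewrite -(mulg1 t).
  apply: (IHn L (translate t Y) (translate t Z)) => //; last exact: vL.
  - apply: leq_trans leKn; rewrite -cL ltn_Pmulr ?cardG_gt0 //.
    exact: prime_gt1.
  - exact: pgroupS pK.
  - exact: coset_free_translate fY.
  - exact: coset_free_translate fZ.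
have [K1|K1] := eqVneq #|K| 1%N; first exact: chi_sum_trivial.
have [[|[|k]] cK] := p_natP pK.
- by rewrite cK in K1.
- have cK1 : #|K| = (p * 1)%N by rewrite cK muln1.
  have [L [H [sLK sHK cL cH [_ _ vL]]]] := chi_sum_coprime_part pr_p cK1 (coprimen1 _).
  have HK : H :=: K by apply/eqP; rewrite eqEcard sHK cK1 cH muln1 /=.
  have {}vL h h' : h \in K -> h' \in K -> (Y h + Z h' = Y h' + Z h)%N.
    rewrite -HK => Hh Hh'; move/eqP: eqYZ; rewrite -subr_eq0 chi_sumB => /eqP YZ.
    have := vL _ YZ h h' Hh Hh'; rewrite /chi_int_sum (card1_trivg cL) !big_set1.
    rewrite phi1 !mulr1 !mulg1 => /eqP; rewrite eqr_int => /eqP; clear; lia.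
  have pr_K : prime #|K| by rewrite cK.
  have [h0 Kh0] := fY K 1%g (subxx _) (group1 _) pr_K; rewrite mul1g => Y0.
  have [h1 Kh1] := fZ K 1%g (subxx _) (group1 _) pr_K; rewrite mul1g => Z1.
  move=> u Ku; have := vL u h0 Ku Kh0; have := vL u h1 Ku Kh1.
  by rewrite Y0 Z1; clear; lia.
by case/negP: p_sq; rewrite cK dvdn_exp2l.
Qed.

Lemma min_weight_witness (T : {set gT}) (w : gT -> nat) t0 :
  t0 \in T -> exists2 t, t \in T & forall t', t' \in T -> (w t <= w t')%N.
Proof.
by move=> Tt0; case: (arg_minnP w Tt0) => t Tt tmin; exists t.
Qed.

(* The weight bound is tailored so that the pairs of components [y h] and
   [z h + V] below inherit it when q >= 11, where [V] is a component of [Y] of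
   least weight among those at which [Z] vanishes.  For q = 7 the components live
   on a 5-group, where no weight bound is needed. *)
Lemma chi_sum_inj_small K Y Z :
  coprime #|K| 6 -> coset_free K Y -> chi_sum K Y = chi_sum K Z ->
  (weight K Y + 10 * weight K Z <= 27)%N -> {in K, Y =1 Z}.
Proof.
have [n] := ubnP #|K|; elim: n => // n IHn in K Y Z *.
rewrite ltnS => leKn coK6 fY eqYZ wYZ.
have primeK p : prime p -> (p %| #|K|)%N -> (5 <= p)%N.
  move=> pr_p pK; have := coprime_dvdl pK coK6.
  by case: p pr_p {pK} => [|[|[|[|[|p]]]]].
have primeH H : H \subset K -> prime #|H| -> (5 <= #|H|)%N.
  by move=> sHK /primeK; apply; apply: cardSg.
(* The bound leaves [Z] weight at most 2, below every prime order here, so [Z] is coset-free too. *)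
have [p5|] := boolP (5.-group K)%g.
  apply: (chi_sum_inj_pgroup _ p5) => //; apply: weight_coset_free => H sHK.
  by move/(primeH H sHK); move: wYZ; clear; lia.
set q := max_pdiv #|K|; rewrite /pgroup => n5K.
have K1 : (1 < #|K|)%N.
  by rewrite ltn_neqAle cardG_gt0 andbT; apply: contraNneq n5K => <-.
have pr_q : prime q by apply: max_pdiv_prime.
have qK : (q %| #|K|)%N by apply: max_pdiv_dvd.
have q7 : (7 <= q)%N.
  rewrite leqNgt; apply: contraNN n5K => q6; apply/pnatP => // p pr_p pK.
  have := primeK p pr_p pK; have := max_pdiv_max (_ : p \in \pi(#|K|)).
  rewrite mem_primes pr_p pK cardG_gt0 -/q => /(_ isT) pq p5.
  have q5 := primeK q pr_q qK; have q_n6 : q != 6%N by apply: contraTneq pr_q => ->.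
  by rewrite inE; apply/eqP; move: q6 p5 pq q5 q_n6; clear; lia.
have [qq|q_sq] := boolP (q ^ 2 %| #|K|)%N.
  have [L [sLK cL /(_ _ _ eqYZ) vL]] := chi_sum_square_eq pr_q qq.
  move=> t Kt; rewrite -(mulg1 t).
  apply: (IHn L (translate t Y) (translate t Z)) => //.
  - apply: leq_trans leKn; rewrite -cL ltn_Pmulr ?cardG_gt0 //.
    exact: prime_gt1.
  - by apply: coprime_dvdl coK6; rewrite cardSg.
  - exact: coset_free_translate fY.
  - exact: vL.
  - have := weight_translate_le Y sLK Kt; have := weight_translate_le Z sLK Kt.
    by move: wYZ; clear; lia.
have [r cK] : exists r, #|K| = (q * r)%N by case/dvdnP: qK => r ->; exists r; apply: mulnC.
have coqr : coprime q r.
  by rewrite prime_coprime //; apply: contraNN q_sq => qr; rewrite cK dvdn_pmul2l ?prime_gt0.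
have [L [H [sLK sHK cL cH [defK sumK vL]]]] := chi_sum_coprime_part pr_q cK coqr.
pose y h := translate h Y; pose z h := translate h Z.
pose wy h := weight L (y h); pose wz h := weight L (z h).
have WY : weight K Y = (\sum_(h in H) wy h)%N by apply: sumK.
have WZ : weight K Z = (\sum_(h in H) wz h)%N by apply: sumK.
(* [S] has at most 2 elements, so [T], which indexes the components where [Z] vanishes, is
   nonempty. *)
pose S := [set h in H | 0 < wz h]%N; pose T := H :\: S.
have sSH : S \subset H by apply/subsetP => h; rewrite inE => /andP[].
have sTH : T \subset H by apply: subsetDl.
have cST : (#|S| + #|T|)%N = q by rewrite -cH -(cardsID S H) (setIidPr sSH).
have leSum (A B : {set gT}) (F : gT -> nat) k : A \subset B ->
    (forall h, h \in A -> k <= F h)%N -> (#|A| * k <= \sum_(h in B) F h)%N.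
  move=> sAB kF; rewrite (big_setID A) /= (setIidPr sAB) -sum_nat_const.
  by apply: leq_trans (leq_addr _ _); apply: leq_sum.
have S1 h : h \in S -> (1 <= wz h)%N by rewrite inE => /andP[].
have T0 h : h \in T -> wz h = 0%N.
  by rewrite !inE => /andP[+ Hh]; rewrite Hh -eqn0Ngt => /eqP.
have cS : (#|S| <= weight K Z)%N by rewrite WZ -(muln1 #|S|) leSum.
have [h1 Th1] : exists h, h \in T.
  by apply/set0Pn; rewrite -card_gt0; move: cST cS wYZ q7; clear; lia.
have [h0 Th0 hmin] := min_weight_witness wy Th1.
pose V := y h0; set w := wy h0 in hmin.
have Hh0 := subsetP sTH _ Th0.
(* All components of [Y - Z] have the same value, which at [h0] is that of [V] because [z h0] has
   weight 0. *)
have key h : h \in H -> chi_sum L (y h) = chi_sum L (fun u => z h u + V u)%N.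
  move=> Hh; move/eqP: eqYZ; rewrite -subr_eq0 chi_sumB => /eqP YZ.
  have := vL _ YZ h h0 Hh Hh0.
  rewrite -(chi_sumB L (y h) (z h)) -(chi_sumB L (y h0) (z h0)) => yz.
  rewrite chi_sumD; apply/eqP; rewrite addrC -subr_eq yz.
  by rewrite [chi_sum L (z h0)]chi_sum_weight0 ?subr0 //; apply: T0.
have fy h : h \in H -> coset_free L (y h).
  by move=> Hh; apply: coset_free_translate fY => //; apply: (subsetP sHK).
have Tw : (#|T| * w <= weight K Y)%N by rewrite WY leSum.
have ltLn : (#|L| < n)%N.
  by apply: leq_trans leKn; rewrite cK cL ltn_Pmull ?prime_gt1 // -cL cardG_gt0.
have coL6 : coprime #|L| 6 by apply: coprime_dvdl coK6; rewrite cardSg.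
have claim h : h \in H -> {in L, y h =1 (fun u => z h u + V u)%N}.
  move=> Hh; have wzZ : (wz h <= weight K Z)%N.
    exact: weight_translate_le sLK (subsetP sHK _ Hh).
  (* For [q = 7] only the prime 5 can divide [#|L|], and [z h + V] weighs less than 5. *)
  have [q_le7|q_gt7] := leqP q 7.
    have q_7 : q = 7%N by apply/eqP; rewrite eqn_leq q_le7.
    apply: (@chi_sum_inj_pgroup 5) => //; last exact: key.
    - apply/pnatP => // p pr_p pL; have pK := dvdn_trans pL (cardSg sLK).
      have := primeK p pr_p pK; have := max_pdiv_max (_ : p \in \pi(#|K|)).
      rewrite mem_primes pr_p pK cardG_gt0 -/q => /(_ isT); rewrite inE /= q_7.
      case: p pr_p pL {pK} => [|[|[|[|[|[|[|[|p]]]]]]]] //= _.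
      by move: coqr; rewrite cL q_7 prime_coprime // => /negP.
    - exact: fy.
    - apply: weight_coset_free => H' sH'L pr_H'.
      apply: leq_trans (primeH H' (subset_trans sH'L sLK) pr_H').
      move: Tw cS wzZ wYZ cST; rewrite weightD -/(wz h) -/(wy h0) -/w q_7 !ltnS.
      move: (weight K Z) (weight K Y) (wz h) (w) #|S| #|T| => [|[|[|Zw]]]; clear; nia.
  apply: IHn => //; first exact: fy; first exact: key.
  rewrite weightD -/(wy h) -/(wz h) -/(wy h0) -/w.
  have cT := cardsD1 h T; have cS' := cardsD1 h S.
  have hST : ((h \in T) + (h \in S) = 1)%N.
    by rewrite /T in_setD Hh andbT; case: (h \in S).
  have boundY : (wy h + #|T :\ h| * w <= weight K Y)%N.
    rewrite WY (big_setD1 h) //= leq_add2l.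
    by apply: leSum; [exact: setSD | move=> k /setD1P[_ Tk]; apply: hmin].
  have boundZ : (wz h + #|S :\ h| <= weight K Z)%N.
    rewrite WZ (big_setD1 h) //= leq_add2l -(muln1 #|_|).
    by apply: leSum; [exact: setSD | move=> k /setD1P[_ Sk]; apply: S1].
  have {q_gt7} q11 : (11 <= q)%N.
    by move: q_gt7 pr_q; case: (q) => [|[|[|[|[|[|[|[|[|[|[|k]]]]]]]]]]].
  move: boundY boundZ cT cS' hST cST wYZ q11.
  move: (weight K Z) (weight K Y) (wz h) (wy h) #|S :\ h| #|T :\ h| #|S| #|T|.
  (* Apart from [h] there are [s] indices in [S] and [a] in [T], with [s + a >= 10]. The excess
     [(10 - a) w] is at most [s w], and as [w <= 3] the [10 s] saved on [Z] absorbs it. *)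
  move=> Zw Yw zh yh s a s' a' bY bZ cT cS' hST cST wYZ q11.
  clear - bY bZ cT cS' hST cST wYZ q11; have a8 : (8 <= a)%N by lia.
  have w3 : (w <= 3)%N by nia.
  by move: bY; case: (w) w3 => [|[|[|[|//]]]] _; lia.
(* If [w = 0] then [V] vanishes and the claim gives [Y = Z]. Otherwise a point where [V] is positive
   is in the support of every component of [Y], which puts a coset of [H] in the support of [Y]. *)
have [w0|w0] := posnP w.
  move=> u /defK[h [l [Hh Ll ->]]]; have := claim h Hh l Ll.
  by rewrite [V l](weight_eq0 w0) // addn0.
have [u Lu Vu] : exists2 u, u \in L & (0 < V u)%N.
  apply/exists_inP; apply: contraTT w0; rewrite negb_exists_in -leqNgt leqn0.
  move/forall_inP=> V0; rewrite /w /wy /weight sum_nat_eq0.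
  by apply/forall_inP => u /V0; rewrite -leqNgt leqn0.
have [|h Hh] := fY H u sHK (subsetP sLK _ Lu); first by rewrite cH.
rewrite mulgCT; have := claim h Hh u Lu; rewrite {1}/y /translate => -> /eqP.
by rewrite addn_eq0 => /andP[_]; rewrite eqn0Ngt Vu.
Qed.

(** * Splitting a vanishing sum into cosets of prime order *)

Definition coset_sum (s : seq ({group gT} * gT)) u : nat :=
  (\sum_(c <- s) (u \in c.2 *: c.1)%g)%N.

Definition prime_cosets (s : seq ({group gT} * gT)) :=
  forall c, c \in s -> prime #|c.1|.

(** Multiplying by some [h0 <> 1] of [H] permutes the coset and scales the sum by [phi h0 <> 1]. *)
Lemma chi_sum_coset H a :
  prime #|H| -> chi_sum [set: gT] (fun u => u \in a *: H)%g = 0.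
Proof.
move=> pr_H; rewrite /chi_sum (bigID (fun u => u \in a *: H)%g) /=.
rewrite [X in _ + X]big1 ?addr0; last by move=> u /andP[_ /negPf->]; rewrite mul0r.
have [h0 Hh0 h01] : exists2 h, h \in H & h != 1%g.
  by apply/trivgPn; rewrite -cardG_gt1 prime_gt1.
under eq_bigl do rewrite inE /=.
under eq_bigr => u -> do rewrite mul1r.
set A := \sum_(i in _) _.
have h0A : phi h0 * A = A.
  rewrite /A mulr_sumr [RHS](reindex_inj (mulgI h0)) /=.
  apply: eq_big => [u|u _]; last by rewrite phiM.
  by rewrite !mem_lcoset !(mulgCT h0) mulgA (groupMr _ Hh0).
have : (phi h0 - 1) * A = 0 by rewrite mulrBl h0A mul1r subrr.
by move/eqP; rewrite mulf_eq0 subr_eq0 -phi1 (inj_eq phi_inj) (negPf h01) => /eqP.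
Qed.

Lemma weight_coset_ind H a :
  weight [set: gT] (fun u => u \in a *: H)%g = #|H|.
Proof.
rewrite -(card_lcoset H a) -sum1_card [RHS]big_mkcond /weight.
by apply: eq_big => [u|u _]; rewrite ?inE //; case: (u \in _).
Qed.

(** Prime cosets inside the support are removed one at a time, each being a vanishing sum. What is
    left is coset-free, hence 0 by [chi_sum_inj_small] with [Z = 0]. *)
Lemma vanishing_sum_prime_cosets X :
  coprime #|gT| 6 -> chi_sum [set: gT] X = 0 -> (weight [set: gT] X <= 27)%N ->
  exists2 s, prime_cosets s & X =1 coset_sum s.
Proof.
move=> co6; have [n] := ubnP (weight [set: gT] X); elim: n => // n IHn in X *.
rewrite ltnS => leXn X0 X27.
have [/existsP[[H a] /= /andP[pr_H /forall_inP XH]]|noH] := boolP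
    [exists c : {group gT} * gT, prime #|c.1| && [forall h in c.1, 0 < X (c.2 * h)%g]%N].
  pose Y u := (X u - (u \in a *: H)%g)%N.
  have XY u : X u = (Y u + (u \in a *: H)%g)%N.
    rewrite /Y subnK //; case: lcosetP => // -[h Hh ->]; exact: XH.
  have wXY : weight [set: gT] X = (weight [set: gT] Y + #|H|)%N.
    rewrite -(weight_coset_ind H a) -weightD; apply: eq_bigr => u _; exact: XY.
  have pos_H := prime_gt0 pr_H.
  have Y0 : chi_sum [set: gT] Y = 0.
    rewrite -X0 -[LHS]addr0 -(chi_sum_coset a pr_H) -chi_sumD.
    by apply: eq_bigr => u _; rewrite XY.
  have ltY : (weight [set: gT] Y < n)%N.
    by apply: leq_trans leXn; rewrite wXY -[ltnLHS]addn0 ltn_add2l.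
  have Y27 : (weight [set: gT] Y <= 27)%N.
    by apply: leq_trans X27; rewrite wXY leq_addr.
  have [s pr_s Ys] := IHn Y ltY Y0 Y27.
  exists ((H, a) :: s).
    by move=> c; rewrite inE => /predU1P[-> //|]; apply: pr_s.
  by move=> u; rewrite /coset_sum big_cons /= XY Ys addnC.
exists [::] => // u; rewrite /coset_sum big_nil.
apply: (@chi_sum_inj_small [set: gT] X (fun=> 0%N)) => //.
- by rewrite cardsT.
- move=> H a _ _ pr_H.
  suffices /exists_inP[h Hh /eqP Xh] : [exists h in H, X (a * h)%g == 0%N] by exists h.
  apply: contraR noH.
  rewrite negb_exists_in => /forall_inP XH; apply/existsP; exists (H, a).
  by rewrite pr_H; apply/forall_inP => h /XH; rewrite lt0n.
- by rewrite X0 [RHS]big1 // => u' _; rewrite mul0r.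
- have -> : weight [set: gT] (fun=> 0%N) = 0%N by apply: big1.
  by rewrite muln0 addn0.
Qed.
End FaithfulCharacter.

(** * Zero-sum triples *)

(* The differences of [f] along an orbit [y, x + y, x + x + y] add up to 0. *)
Lemma triple_weight (G : finZmodType) (A : zmodType) (f : G -> A) (x : G)
    (W : A -> nat) (k : nat) :
  x *+ 3 = 0 -> (forall u v w, u + v + w = 0 -> (3 * k <= W u + W v + W w)%N) ->
  (k * #|G| <= \sum_y W (f (x + y) - f y)%R)%N.
Proof.
move=> x3 W3; pose d y := f (x + y) - f y.
rewrite -(leq_pmul2l (isT : 0 < 3)%N) mulnA mulnC -sum_nat_const.
have shift z : (\sum_y W (d y) = \sum_y W (d (z + y)%R))%N.
  by rewrite (reindex_inj (addrI z)).
have -> : (3 * \sum_y W (d y) =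
    \sum_y (W (d y) + W (d (x + y)%R) + W (d (x + x + y)%R)))%N.
  rewrite !big_split /= -(shift x) -(shift (x + x)).
  by rewrite !mulSn mul0n addn0 addnA.
apply: leq_sum => y _; apply: W3; rewrite /d.
have -> : f (x + (x + x + y)) = f y.
  by congr f; rewrite !addrA -mulr2n -mulrSr x3 add0r.
rewrite -(addrA x x) [X in X + _]addrC.
by rewrite !addrA !subrK subrr.
Qed.

(* For residues [b], [c] mod 5, not both 0, a weight on the residues mod 5
   that is at least 2 on average on every zero-sum triple but less than 2 on
   average on the multiset made of each residue once, and [b] and [c] eleven
   times each; up to scaling only the ratio [c / b = c * b ^ 3] matters. *)
Definition weight5 (b c v : nat) : nat :=
  if b == 0%N then nth 0%N [:: 2; 1; 3; 4; 3]%N (v * c ^ 3 %% 5) else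
  nth 0%N (nth [::] [:: [:: 2; 1; 3; 4; 3]; [:: 4; 1; 4; 4; 4];
    [:: 2; 0; 3; 6; 4]; [:: 2; 3; 4; 0; 6]; [:: 4; 1; 4; 4; 1]]%N
      (c * b ^ 3 %% 5)) (v * b ^ 3 %% 5).

Lemma weight5P b c : (b < 5 -> c < 5 -> (b == 0) && (c == 0) = false ->
  [/\ forall u v w, (u + v + w) %% 5 = 0 ->
       6 <= weight5 b c (u %% 5) + weight5 b c (v %% 5) + weight5 b c (w %% 5) &
   \sum_(i < 5) weight5 b c i + 11 * weight5 b c b + 11 * weight5 b c c < 54])%N.
Proof.
(* Only residues mod 5 matter, so a finite computation suffices. The bound 54 is what nine zero-sum
   triples of weight at least 6 would reach. *)
pose ok b c := let w := weight5 b c in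
  ((b == 0) && (c == 0) || all (fun u => all (fun v => all (fun t =>
    ((u + v + t) %% 5 == 0) ==> (6 <= w u + w v + w t))
    (iota 0 5)) (iota 0 5)) (iota 0 5) &&
  (w 0 + (w 1 + (w 2 + (w 3 + w 4))) + 11 * w b + 11 * w c < 54))%N.
have ok_all : all (fun b => all (ok b) (iota 0 5)) (iota 0 5) by vm_compute.
have mem5 i : (i < 5)%N -> i \in iota 0 5 by rewrite mem_iota.
move=> b5 c5 bc0.
have := allP (allP ok_all b (mem5 b b5)) c (mem5 c c5).
rewrite /ok bc0 orFb => /andP[ok3 total]; split; last first.
  by rewrite !big_ord_recl big_ord0 addn0.
move=> u v w uvw; have mod5 i : (i %% 5)%N \in iota 0 5 by rewrite mem5 ?ltn_mod.
have /implyP := allP (allP (allP ok3 _ (mod5 u)) _ (mod5 v)) _ (mod5 w); apply.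
by rewrite modnDmr -(modnDml _ w) modnDm modnDml uvw.
Qed.

(** * Weights that exclude a partition into zero-sum triples *)

Section Obstruction.
Variable R : comNzRingType.
Hypotheses (tf2 : forall v : R, v *+ 2 = 0 -> v = 0)
           (tf3 : forall v : R, v *+ 3 = 0 -> v = 0).
Implicit Types a b c u v w : R.

(* A Farkas certificate that the multiset with [a] five times, and [b] and [c]
   eleven times each, is not a union of nine zero-sum triples. *)
Definition obstructed a b c := exists (W : R -> nat) (k : nat),
  (forall u v w, u + v + w = 0 -> (3 * k <= W u + W v + W w)%N) /\
  (5 * W a + 11 * W b + 11 * W c < 27 * k)%N.

Let W1 p v : nat := if v == p then 0%N else if v == 0 then 1%N else 3%N.

(** A zero-sum triple avoiding the weight 3 is made of [p] and 0, and [p], [2p], [3p] are nonzero,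
    so it is three times 0. *)
Let W1P p u v w : p != 0 -> u + v + w = 0 -> (3 * 1 <= W1 p u + W1 p v + W1 p w)%N.
Proof.
move=> p0; have p2 : p *+ 2 <> 0 by move/tf2/eqP; apply/negP.
have p3 : p *+ 3 <> 0 by move/tf3/eqP; apply/negP.
rewrite /W1; have [->|_] := eqVneq u p; have [->|_] := eqVneq v p;
have [->|_] := eqVneq w p; try lia.
- by move=> e; case: p3; rewrite -e; ring.
- by case: eqVneq => [->|_]; [move=> e; case: p2; rewrite -e; ring | lia].
- by case: eqVneq => [->|_]; [move=> e; case: p2; rewrite -e; ring | lia].
- case: eqVneq => [->|_]; last by lia.
  by case: eqVneq => [->|_]; [move=> e; case/eqP: p0; rewrite -e; ring | lia].
- by case: eqVneq => [->|_]; [move=> e; case: p2; rewrite -e; ring | lia].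
- case: eqVneq => [->|_]; last by lia.
  by case: eqVneq => [->|_]; [move=> e; case/eqP: p0; rewrite -e; ring | lia].
- case: eqVneq => [->|_]; last by lia.
  by case: eqVneq => [->|_]; [move=> e; case/eqP: p0; rewrite -e; ring | lia].
- by do 3 case: eqVneq => _.
Qed.

Lemma obstructedC a b c : obstructed a b c -> obstructed a c b.
Proof. by case=> W [k [W3 Wk]]; exists W, k; split=> //; lia. Qed.

(** Here [b + b + c = 0] and [c + c + 4b = 0], so the weights depend on whether [a] is [4b]. *)
Lemma obstructed_double a b : b != 0 -> obstructed a b (- (b *+ 2)).
Proof.
move=> b0; set c := - _; set b4 := b *+ 4.
have b3 : b *+ 3 <> 0 by move/tf3/eqP; apply/negP.
have b6 : b *+ 6 <> 0 by rewrite (mulrnA b 3 2) => /tf2.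
have b9 : b *+ 9 <> 0 by rewrite (mulrnA b 3 3) => /tf3.
have b12 : b *+ 12 <> 0 by rewrite (mulrnA b 6 2) => /tf2.
have cb : c != b by apply/eqP=> e; apply: b3; rewrite -(subrr b) -{3}e /c; ring.
have b4b : b4 != b.
  by apply/eqP=> e; apply: b3; rewrite -(subrr b) -{2}e /b4; ring.
have b4c : b4 != c.
  by apply/eqP=> e; apply: b6; rewrite -(subrr c) -{1}e /b4 /c; ring.
have [->|ab4] := eqVneq a b4.
  (* Within [b], [c], [4b] only the triples [b, b, c] and [c, c, 4b] have sum 0, both of weight 12;
     the total is [33 + 66 = 99 < 108]. *)
  exists (fun v => if v == b then 3%N else if v == c then 6%N
                   else if v == b4 then 0%N else 12%N), 4%N; split; last first.
    by rewrite !eqxx (negPf cb) (negPf b4b) (negPf b4c).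
  move=> u v w.
  have [->|_] := eqVneq u b; [|have [->|_] := eqVneq u c;
    [|have [->|_] := eqVneq u b4; last by move=> _; lia]];
  (have [->|_] := eqVneq v b; [|have [->|_] := eqVneq v c;
    [|have [->|_] := eqVneq v b4; last by move=> _; lia]]);
  (have [->|_] := eqVneq w b; [|have [->|_] := eqVneq w c;
    [|have [->|_] := eqVneq w b4; last by move=> _; lia]]) => // e; exfalso;
  move: e; rewrite /b4 /c => e;
  first [ by apply: b3; rewrite -e; ring | by apply: b6; rewrite -e; ring
        | by apply: b9; rewrite -e; ring | by apply: b12; rewrite -e; ring
        | by apply: b3; rewrite -oppr0 -e; ring
        | by apply: b6; rewrite -oppr0 -e; ring ].
(* Two copies of [c] force the third element to be [4b], of weight 6; with at most one [c] the other
   two weigh at least 3 each. As [a <> 4b], the total is at most [20 + 33 = 53 < 54]. *)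
pose W v : nat := if v == b then 3%N else if v == c then 0%N
                  else if v == b4 then 6%N else 4%N.
exists W, 2%N; split; last first.
  rewrite /W !eqxx (negPf cb) (negPf ab4).
  by case: (a == b); case: (a == c).
have cc v : c + c + v = 0 -> W v = 6%N.
  move=> e; have -> : v = b4.
    by apply/eqP; rewrite -subr_eq0 -e /b4 /c; apply/eqP; ring.
  by rewrite /W (negPf b4b) (negPf b4c) eqxx.
have W3 v : v != c -> (3 <= W v)%N.
  by rewrite /W => /negPf->; case: (v == b); case: (v == b4).
move=> u v w e.
have [uc|/W3] := eqVneq u c; have [vc|/W3] := eqVneq v c;
have [wc|/W3] := eqVneq w c; try lia.
- by rewrite [W w]cc -?e ?uc ?vc // addnC.
- by rewrite [W w]cc ?leq_addl // -e uc vc.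
- by rewrite [W v]cc -?e ?uc ?wc; [lia | ring].
- by rewrite [W u]cc -?e ?vc ?wc; [lia | ring].
Qed.

(** Unless [b] and [c] are distinct and nonzero, [W1] at a nonzero value works: the totals are at
    most 22 for [b = c = 0], 26 if one of them is 0, and 15 for [b = c]. *)
Lemma obstructed_nonzero a b c :
  ~~ [&& a == 0, b == 0 & c == 0] -> obstructed a b c.
Proof.
have WP p : p != 0 -> (5 * W1 p a + 11 * W1 p b + 11 * W1 p c < 27)%N ->
    obstructed a b c.
  by move=> p0 lt27; exists (W1 p), 1%N; split=> // u v w; apply: W1P.
have W1le p : (W1 p a <= 3)%N by rewrite /W1; case: (a == p); case: (a == 0).
have W1p p : W1 p p = 0%N by rewrite /W1 eqxx.
have W10 p : p != 0 -> W1 p 0 = 1%N by rewrite /W1 eq_sym eqxx => /negPf->.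
have [b0|b0] := eqVneq b 0; have [c0|c0] := eqVneq c 0.
- by rewrite !andbT => a0; apply: (WP a) => //; rewrite W1p b0 c0 W10.
- by move=> _; apply: (WP c) => //; have := W1le c; rewrite W1p b0 W10 //; lia.
- by move=> _; apply: (WP b) => //; have := W1le b; rewrite W1p c0 W10 //; lia.
move=> _; have [bc|bc] := eqVneq b c.
  by apply: (WP b) => //; have := W1le b; rewrite -bc W1p; lia.
have [->|cb2] := eqVneq c (- (b *+ 2)); first exact: obstructed_double.
have [->|bc2] := eqVneq b (- (c *+ 2)).
  exact/obstructedC/obstructed_double.
(* No zero-sum triple is made of [b] and [c] alone, since [3b], [3c], [2b + c] and [b + 2c] are
   nonzero. *)
exists (fun v => if (v == b) || (v == c) then 0%N else 3%N), 1%N.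
rewrite !eqxx orbT; split; last by case: ifP.
have b3 : b *+ 3 <> 0 by move/tf3/eqP; apply/negP.
have c3 : c *+ 3 <> 0 by move/tf3/eqP; apply/negP.
have cb2' : b *+ 2 + c <> 0.
  by move/eqP; rewrite addrC addr_eq0; apply/negP.
have bc2' : c *+ 2 + b <> 0.
  by move/eqP; rewrite addrC addr_eq0; apply/negP.
move=> u v w e.
case: ifP => [/orP|_]; last by lia.
case: ifP => [/orP|_]; last by lia.
case: ifP => [/orP|_]; last by lia.
case=> /eqP wE; case=> /eqP vE; case=> /eqP uE; exfalso; move: e; rewrite uE vE wE => e;
first [ by apply: b3; rewrite -e; ring | by apply: c3; rewrite -e; ring
      | by apply: cb2'; rewrite -e; ring | by apply: bc2'; rewrite -e; ring ].
Qed.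
End Obstruction.

(** * Generalized bent functions on a group of order 27 *)

Section DiscreteLog.
Variables (gT : finGroupType) (g : gT) (m : nat).
Hypotheses (m_gt1 : (1 < m)%N) (gen_g : generator [set: gT] g)
           (ord_g : #[g]%g = m).

(** As [g] generates a group of order [m], the search always succeeds and inverts [i |-> g ^+ i]. *)
Definition dlog (u : gT) : 'Z_m := odflt 0 [pick i : 'Z_m | (g ^+ i)%g == u].

Lemma expg_natr n : (g ^+ (n%:R : 'Z_m))%g = (g ^+ n)%g.
Proof. by rewrite val_Zp_nat // -ord_g expg_mod_order. Qed.

Lemma expgD_Zp (i j : 'Z_m) : (g ^+ (i + j)%R)%g = (g ^+ i * g ^+ j)%g.
Proof. by rewrite -{1}(natr_Zp i) -{1}(natr_Zp j) -natrD expg_natr expgD. Qed.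

Lemma ltn_Zp (i : 'Z_m) : (i < m)%N.
Proof. by have := ltn_ord i; rewrite [X in (_ < X)%N]Zp_cast. Qed.

Lemma expg_Zp_inj : injective (fun i : 'Z_m => (g ^+ i)%g).
Proof.
move=> i j /= /eqP; rewrite eq_expg_mod_order ord_g !modn_small ?ltn_Zp //.
by move/eqP/val_inj.
Qed.

Lemma dlogK u : (g ^+ dlog u)%g = u.
Proof.
rewrite /dlog; case: pickP => [i /eqP //|no]; have : u \in [set: gT] by [].
rewrite (eqP gen_g) => /cycleP[i ui]; have := no i%:R.
by rewrite expg_natr ui eqxx.
Qed.

Lemma dlog_expg (i : 'Z_m) : dlog (g ^+ i)%g = i.
Proof. by apply: expg_Zp_inj; rewrite /= dlogK. Qed.

Lemma dlogM u v : dlog (u * v)%g = dlog u + dlog v.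
Proof. by apply: expg_Zp_inj; rewrite /= expgD_Zp !dlogK. Qed.

Lemma dlog1 : dlog 1%g = 0.
Proof. by apply: (addrI (dlog 1)); rewrite -dlogM mulg1 addr0. Qed.

Lemma dlogX u n : dlog (u ^+ n)%g = dlog u *+ n.
Proof.
by elim: n => [|n IHn]; rewrite ?dlog1 // expgS mulrS dlogM IHn.
Qed.

Lemma dlog_inj : injective dlog.
Proof. by move=> u v uv; rewrite -(dlogK u) uv dlogK. Qed.

Lemma dlogV u : dlog (u^-1)%g = - dlog u.
Proof. by apply/eqP; rewrite -addr_eq0 -dlogM mulVg dlog1. Qed.

Lemma dlog_card (H : {group gT}) h : h \in H -> dlog h *+ #|H| = 0.
Proof. by move=> Hh; rewrite -dlogX expg_cardG // dlog1. Qed.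

Lemma Zp_mulrn_eq0 (i : 'Z_m) n : (i *+ n == 0) = (m %| i * n)%N.
Proof.
rewrite -{1}(natr_Zp i) -mulrnA -(inj_eq val_inj) /=.
by rewrite val_Zp_nat.
Qed.

Lemma Zp_eq0_dvd (i : 'Z_m) : (m %| i)%N -> i = 0.
Proof.
by move=> mi; apply/eqP; rewrite -(mulr1n i) Zp_mulrn_eq0 muln1.
Qed.

Lemma Zp_mulrn_coprime (i : 'Z_m) n : coprime m n -> i *+ n = 0 -> i = 0.
Proof.
move=> co /eqP; rewrite Zp_mulrn_eq0 Gauss_dvdl // => /Zp_eq0_dvd; exact.
Qed.

Lemma mulrn_coprime (A : zmodType) (i : A) a b :
  coprime a b -> i *+ a = 0 -> i *+ b = 0 -> i = 0.
Proof.
move=> co ia ib; have [a0|a_gt0] := posnP a.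
  by move: co ib; rewrite a0 /coprime gcd0n => /eqP->.
have [u v e _] := egcdnP b a_gt0; move: e; rewrite (eqP co).
move=> /(congr1 (fun n => i *+ n)).
by rewrite mulrnDr (mulnC u) (mulnC v) !mulrnA ia ib !mul0rn add0r.
Qed.

Lemma E_at (G : finZmodType) (f : G -> 'Z_m) x u :
  E_ g f x u = (\sum_y (u == g ^+ (f (x + y) - f y)%R)%g)%N.
Proof. by rewrite /E_ sum_ffunE; apply: eq_bigr => y _; rewrite ffunE. Qed.

(** Double counting: [E_x] is the multiset of powers of [g] at the differences and also the union of
    the cosets with multiplicity. *)
Lemma E_sum (G : finZmodType) (f : G -> 'Z_m) x s (W : 'Z_m -> nat) :
  E_ g f x =1 coset_sum s ->
  (\sum_y W (f (x + y) - f y)%R =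
   \sum_(c <- s) \sum_(h in c.1) W (dlog c.2 + dlog h)%R)%N.
Proof.
move=> Es; transitivity (\sum_u E_ g f x u * W (dlog u))%N.
  have [e Ee de] : exists2 e : G -> gT, forall u, E_ g f x u = (\sum_y (u == e y))%N &
      forall y, dlog (e y) = f (x + y) - f y.
    by exists (fun y => (g ^+ (f (x + y) - f y)%R)%g) => *; [exact: E_at | exact: dlog_expg].
  under [RHS]eq_bigr do rewrite Ee big_distrl /=.
  rewrite exchange_big /=; apply: eq_bigr => y _.
  rewrite (bigD1 (e y)) //= eqxx mul1n de.
  by rewrite big1 ?addn0 // => u /negPf->.
under eq_bigr do rewrite Es /coset_sum big_distrl /=.
rewrite exchange_big /=; apply: eq_bigr => -[H a] _ /=.
rewrite (reindex_inj (mulgI a)) [RHS]big_mkcond /=; apply: eq_bigr => h _.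
by rewrite mem_lcoset mulKg dlogM; case: (h \in H); rewrite ?mul1n ?mul0n.
Qed.
End DiscreteLog.

(** Serves for the weight 27 - 7 left beside a coset of order 7. By parity the number of terms is
    even; two terms never give 20, and four only as 5 + 5 + 5 + 5. *)
Lemma sumn_5_7_11 (l : seq nat) :
  {subset l <= [:: 5; 7; 11]%N} -> sumn l = 20%N -> all (pred1 5%N) l.
Proof.
move=> sub; have {sub} : all (fun a => a \in [:: 5; 7; 11]%N) l by apply/allP.
by case: l => [|a [|b [|c [|d [|e l]]]]] //=; rewrite !inE; lia.
Qed.

(* Classes of at most 23 elements give at most [23 * 27 = 621] coincidences; a
   class of 24 gives at most 585, a larger one at least 627. *)
Lemma no_625_coincidences (n : 'I_5 -> nat) :
  (\sum_i n i = 27 -> \sum_i n i * n i = 625 -> False)%N.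
Proof.
move=> s1 s2.
have [/existsP[i ni]|] := boolP [exists i, 24 <= n i]%N; last first.
  rewrite negb_exists => /forallP small.
  suff : (\sum_i n i * n i <= 23 * \sum_i n i)%N by rewrite s1 s2.
  rewrite big_distrr /=; apply: leq_sum => i _; rewrite leq_mul2r.
  by have := small i; rewrite -ltnNge ltnS => ->; rewrite orbT.
move: s1; rewrite (bigD1 i) //= => s1; move: s2; rewrite (bigD1 i) //= => s2; move: s1 s2.
set r := (\sum_(j | _) n j)%N; set q := (\sum_(j | _) n j * n j)%N.
have rq : (r <= q)%N by rewrite /r /q; apply: leq_sum => j _; case: (n j) => // k; apply: leq_pmulr.
have qr : (q <= r * r)%N.
  rewrite /q {1}/r big_distrl /=; apply: leq_sum => j ji; rewrite leq_mul2l.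
  by rewrite /r (bigD1 j) //= leq_addr orbT.
move: (n i) ni rq qr => k; move: r q; clear => r q k24 rq qr kr kq.
have rE : r = (27 - k)%N by lia.
have : k \in iota 24 4 by rewrite mem_iota; lia.
by rewrite !inE => /or4P[] /eqP kE; move: kq qr rq; rewrite rE kE /=; lia.
Qed.

(** * Exclusion of the coset orders 5, 11, 11 *)

Section BentCombinatorics.
Variables (m' : nat) (gT : finGroupType) (g : gT) (G : finZmodType).
Let m := (5 * m')%N.
Hypotheses (m_gt1 : (1 < m)%N) (gen_g : generator [set: gT] g)
  (ord_g : #[g]%g = m) (co6 : coprime m 6) (co5 : coprime 5 m')
  (card_G : #|G| = 27%N) (G3 : forall x : G, x *+ 3 = 0).
Variable f : G -> 'Z_m.
Hypothesis fdec : forall x : G, x != 0 ->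
  exists2 s, prime_cosets s & E_ g f x =1 coset_sum s.
Local Notation dlog := (@dlog gT g m).
Implicit Types (c : {group gT} * gT) (s : seq ({group gT} * gT)).

Let card_gT : #|gT| = m.
Proof. by rewrite -ord_g orderE -(eqP gen_g) cardsT. Qed.

Let dvd5m : (5 %| m)%N.
Proof. exact: dvdn_mulr. Qed.

Lemma modn5D (i j : 'Z_m) : ((i + j)%R %% 5 = (i + j) %% 5)%N.
Proof.
rewrite -[in LHS](natr_Zp i) -[in LHS](natr_Zp j) -natrD val_Zp_nat //.
by rewrite modn_dvdm.
Qed.

Lemma modn5_triple (u v w : 'Z_m) : u + v + w = 0 -> ((u + v + w) %% 5 = 0)%N.
Proof.
by move/(congr1 (fun i : 'Z_m => i %% 5)%N); rewrite modn5D -modnDml modn5D modnDml.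
Qed.

Lemma prime_coset_ge5 s c : prime_cosets s -> c \in s -> (5 <= #|c.1|)%N.
Proof.
move=> pr_s sc; have := pr_s c sc.
have /coprime_dvdl/(_ co6) : (#|c.1| %| m)%N.
  by rewrite -card_gT -cardsT cardSg ?subsetT.
by case: #|_| => [|[|[|[|[|p]]]]].
Qed.

Lemma coset_sum_card s x :
  E_ g f x =1 coset_sum s -> (\sum_(c <- s) #|c.1| = 27)%N.
Proof.
move=> Es; have := E_sum m_gt1 gen_g ord_g (fun=> 1%N) Es.
rewrite sum1_card [#|_|]card_G => ->.
by apply: eq_bigr => c _; rewrite sum1_card.
Qed.

Lemma modn5_coset c h :
  coprime 5 #|c.1| -> h \in c.1 -> ((dlog c.2 + dlog h)%R %% 5 = dlog c.2 %% 5)%N.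
Proof.
move=> co Hh; rewrite modn5D -modnDmr; suff /eqP-> : (5 %| dlog h)%N by rewrite addn0.
have /eqP := dlog_card m_gt1 gen_g ord_g Hh; rewrite Zp_mulrn_eq0 //.
by move/(dvdn_trans dvd5m); rewrite Gauss_dvdl.
Qed.

(** An element killed by 5 has logarithm divisible by [m'], which is coprime to 5, so it is trivial
    if 5 divides the logarithm too. Hence the five residues are distinct. *)
Lemma sum_coset5 c (w : nat -> nat) :
  #|c.1| = 5%N ->
  (\sum_(h in c.1) w ((dlog c.2 + dlog h)%R %% 5) = \sum_(i < 5) w i)%N.
Proof.
case: c => H a /= cH.
pose r h : 'I_5 := inord ((dlog a + dlog h)%R %% 5)%N.
have rE h : r h = ((dlog a + dlog h)%R %% 5)%N :> nat by rewrite inordK ?ltn_mod.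
have r_inj : {in H &, injective r}.
  move=> h h' Hh Hh' /(congr1 val) /=; rewrite !rE !modn5D => /eqP.
  rewrite eqn_modDl => hh'; apply/eqP; rewrite eq_mulVg1; apply/eqP.
  set k := (h^-1 * h')%g; have Hk : k \in H by rewrite groupM ?groupV.
  apply: (dlog_inj m_gt1 gen_g ord_g); rewrite dlog1 //.
  have k5 : (5 %| dlog k)%N.
    have : (dlog h' %% 5 == (dlog h + dlog k) %% 5)%N.
      by rewrite -modn5D -dlogM // mulKVg.
    by rewrite -(eqP hh') -{1}(addn0 (dlog h)) eqn_modDl eq_sym mod0n.
  have /eqP := dlog_card m_gt1 gen_g ord_g Hk; rewrite cH Zp_mulrn_eq0 //.
  rewrite mulnC dvdn_pmul2l // => m'k; apply: Zp_eq0_dvd => //.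
  by rewrite Gauss_dvd // k5.
transitivity (\sum_(h in H) w (r h))%N; first by apply: eq_bigr => h _; rewrite rE.
rewrite -(big_imset (fun i : 'I_5 => w i) r_inj) /=.
apply: eq_bigl => i; have -> // : r @: H = [set: 'I_5]; rewrite ?inE //.
by apply/eqP; rewrite eqEcard subsetT cardsT card_ord card_in_imset ?cH.
Qed.

Definition type_5_11_11 x := exists c1 c2 c3 : {group gT} * gT,
  [/\ #|c1.1| = 5%N, #|c2.1| = 11%N, #|c3.1| = 11%N &
      E_ g f x =1 coset_sum [:: c1; c2; c3]].

(** The other cosets weigh 16 in all, with prime orders at least 5: 16 is not prime, two orders must
    be 5 and 11, three have an odd sum, four exceed 16. *)
Lemma type_of_11 x s c : prime_cosets s -> E_ g f x =1 coset_sum s ->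
  c \in s -> #|c.1| = 11%N -> type_5_11_11 x.
Proof.
move=> pr_s Es sc c11; have s27 := coset_sum_card Es.
have sE := perm_to_rem sc; set t := rem c s in sE.
have t16 : (\sum_(d <- t) #|d.1| = 16)%N.
  by move: s27; rewrite (perm_big _ sE) big_cons c11 => /eqP; rewrite (eqn_add2l 11 _ 16) => /eqP.
have Et : E_ g f x =1 coset_sum (c :: t).
  by move=> u; rewrite Es /coset_sum; apply: perm_big.
have t5 d : d \in t -> prime #|d.1| /\ (5 <= #|d.1|)%N.
  by move=> /mem_rem sd; split; [apply: pr_s | apply: prime_coset_ge5 pr_s _].
case: t t16 t5 Et {sE} => [|c1 [|c2 [|c3 t]]].
- by rewrite big_nil.
- rewrite big_seq1 => t16 /(_ c1 (mem_head _ _))[]; by rewrite t16.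
- rewrite big_cons big_seq1 => t16 t5 Et.
  have [pr1 ge1] := t5 c1 (mem_head _ _).
  have [|pr2 ge2] := t5 c2; first by rewrite !inE eqxx orbT.
  have /orP[/andP[/eqP e1 /eqP e2]|/andP[/eqP e1 /eqP e2]] :
      (#|c1.1| == 5%N) && (#|c2.1| == 11%N) || (#|c1.1| == 11%N) && (#|c2.1| == 5%N).
  + move: #|c1.1| #|c2.1| pr1 pr2 ge1 ge2 t16 => p1 p2 pr1 pr2 ge1 ge2 t16.
    have p2E : p2 = (16 - p1)%N by lia.
    have : p1 \in iota 5 7 by rewrite mem_iota; lia.
    by rewrite !inE p2E in pr2 *; case/or4P=> [||| /or4P[]] /eqP p1E; move: pr1 pr2; rewrite p1E.
  + exists c1, c2, c; split=> // u; rewrite Et /coset_sum; apply: perm_big.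
    by rewrite -(perm_rot 1).
  + exists c2, c1, c; split=> // u; rewrite Et /coset_sum; apply: perm_big.
    by rewrite -[X in perm_eq X _]/(rev [:: c2; c1; c]) perm_rev.
- rewrite !big_cons => t16 t5; exfalso.
  have [pr1 ge1] := t5 c1 (mem_head _ _).
  have [|pr2 ge2] := t5 c2; first by rewrite !inE eqxx orbT.
  have [|pr3 ge3] := t5 c3; first by rewrite !inE eqxx !orbT.
  case: t t16 t5 => [|c4 t].
    rewrite big_nil addn0 => /(congr1 odd) + _; rewrite !oddD.
    have odd_c (d : {group gT} * gT) : prime #|d.1| -> (5 <= #|d.1|)%N -> odd #|d.1|.
      by move=> pr_d ge_d; have [e|//] := even_prime pr_d; rewrite e in ge_d.
    by rewrite !odd_c.
  rewrite big_cons => t16 /(_ c4); rewrite !inE eqxx !orbT => /(_ isT)[_ ge4].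
  move: t16 ge1 ge2 ge3 ge4; clear; lia.
Qed.

Lemma type_sum x c1 c2 c3 W : E_ g f x =1 coset_sum [:: c1; c2; c3] ->
  (\sum_y W (f (x + y) - f y)%R = \sum_(h in c1.1) W (dlog c1.2 + dlog h)%R +
   \sum_(h in c2.1) W (dlog c2.2 + dlog h)%R +
   \sum_(h in c3.1) W (dlog c3.2 + dlog h)%R)%N.
Proof.
move/(E_sum m_gt1 gen_g ord_g W) => ->.
by rewrite !big_cons big_nil addn0 addnA.
Qed.

Lemma sum_modn5_coset11 c (w : nat -> nat) : #|c.1| = 11%N ->
  (\sum_(h in c.1) w ((dlog c.2 + dlog h)%R %% 5) = 11 * w (dlog c.2 %% 5))%N.
Proof.
move=> c11; rewrite -c11 -sum_nat_const; apply: eq_bigr => h Hh.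
by rewrite modn5_coset // c11.
Qed.

(** Mod 5 the coset of order 5 takes each residue once and those of order 11 are constant, so unless
    both constants are 0, [weight5] would give the nine triples a total below 54. *)
Lemma type_mod5 x c1 c2 c3 :
  #|c1.1| = 5%N -> #|c2.1| = 11%N -> #|c3.1| = 11%N ->
  E_ g f x =1 coset_sum [:: c1; c2; c3] ->
  (dlog c2.2 %% 5 = 0)%N /\ (dlog c3.2 %% 5 = 0)%N.
Proof.
move=> e1 e2 e3 Ex; set b := (dlog c2.2 %% 5)%N; set c := (dlog c3.2 %% 5)%N.
have [/andP[/eqP-> /eqP->] //|/negbTE bc0] := boolP ((b == 0%N) && (c == 0%N)).
have [w3 w54] := weight5P (ltn_mod _ _ : b < 5)%N (ltn_mod _ _ : c < 5)%N bc0.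
pose W (v : 'Z_m) := weight5 b c (v %% 5)%N.
have W3 (u v w : 'Z_m) : u + v + w = 0 -> (3 * 2 <= W u + W v + W w)%N.
  by move=> uvw; apply: w3; apply: modn5_triple.
have := triple_weight f (G3 x) W3; rewrite [#|_|]card_G (type_sum W Ex) /W.
by rewrite (sum_coset5 _ e1) !sum_modn5_coset11 // -/b -/c leqNgt w54.
Qed.

Lemma coset_torsion (H : {group gT}) h n :
  h \in H -> (#|H| %| n)%N -> dlog h *+ n = 0.
Proof.
by move=> Hh /dvdnP[d ->]; rewrite mulnC mulrnA dlog_card // mul0rn.
Qed.

(** Multiplication by 55 collapses each coset to one value, leaving the multiset that
    [obstructed_nonzero] excludes unless all values are 0. *)
Lemma type_torsion x c1 c2 c3 :
  #|c1.1| = 5%N -> #|c2.1| = 11%N -> #|c3.1| = 11%N ->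
  E_ g f x =1 coset_sum [:: c1; c2; c3] ->
  [/\ dlog c1.2 *+ 55 = 0, dlog c2.2 *+ 55 = 0 & dlog c3.2 *+ 55 = 0].
Proof.
move=> e1 e2 e3 Ex.
set a := dlog c1.2 *+ 55; set b := dlog c2.2 *+ 55; set c := dlog c3.2 *+ 55.
have [/and3P[/eqP-> /eqP-> /eqP->] //|abc0] := boolP [&& a == 0, b == 0 & c == 0].
have tf n : coprime m n -> forall v : 'Z_m, v *+ n = 0 -> v = 0.
  by move=> co v; apply: Zp_mulrn_coprime.
have co2 : coprime m 2 by apply: coprime_dvdr co6.
have co3 : coprime m 3 by apply: coprime_dvdr co6.
have [W [k [W3]]] := obstructed_nonzero (tf _ co2) (tf _ co3) abc0.
pose V (v : 'Z_m) := W (v *+ 55).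
have V3 (u v w : 'Z_m) : u + v + w = 0 -> (3 * k <= V u + V v + V w)%N.
  by move=> uvw; apply: W3; rewrite -!mulrnDl uvw mul0rn.
have const c' n : #|c'.1| = n -> (n %| 55)%N ->
    (\sum_(h in c'.1) V (dlog c'.2 + dlog h)%R = n * V (dlog c'.2))%N.
  move=> cn n55; rewrite -cn -sum_nat_const; apply: eq_bigr => h Hh.
  by rewrite /V mulrnDl (coset_torsion Hh) ?cn // addr0.
rewrite ltnNge => /negP[]; have := triple_weight f (G3 x) V3.
by rewrite [#|_|]card_G (type_sum V Ex) (const _ _ e1) // (const _ _ e2) // (const _ _ e3) // mulnC.
Qed.

Lemma type_invariant x : type_5_11_11 x ->
  forall y, f (x + y) *+ 55 = f y *+ 55.
Proof.
case=> c1 [c2 [c3 [e1 e2 e3 Ex]]] y; apply/eqP.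
have [t1 t2 t3] := type_torsion e1 e2 e3 Ex.
pose W (v : 'Z_m) : nat := v *+ 55 != 0.
have zero c : (#|c.1| %| 55)%N -> dlog c.2 *+ 55 = 0 ->
    (\sum_(h in c.1) W (dlog c.2 + dlog h)%R = 0)%N.
  move=> n55 t; apply: big1 => h Hh.
  by rewrite /W mulrnDl t (coset_torsion Hh) // addr0 eqxx.
have := type_sum W Ex; rewrite !zero ?e1 ?e2 ?e3 // => /eqP.
rewrite sum_nat_eq0 => /forallP/(_ y).
by rewrite eqb0 negbK mulrnBl subr_eq0.
Qed.

(** [23 = 1 + 11 + 11]: one element of the coset of order 5 has residue 0, and so do all those of
    the other two. *)
Lemma type_count x : type_5_11_11 x ->
  (\sum_y (f (x + y)%R %% 5 == f y %% 5) = 23)%N.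
Proof.
case=> c1 [c2 [c3 [e1 e2 e3 Ex]]].
have [b0 c0] := type_mod5 e1 e2 e3 Ex.
pose w i : nat := i == 0%N; pose W (v : 'Z_m) := w (v %% 5)%N.
have := type_sum W Ex; rewrite /W (sum_coset5 w e1) !(sum_modn5_coset11 w) //.
rewrite b0 c0 !big_ord_recl big_ord0 => sW; apply: (etrans _ sW); apply: eq_bigr => y _.
rewrite /w; set u := f (x + y); set v := f y.
have -> : (u %% 5 = ((u - v)%R + v) %% 5)%N by rewrite -modn5D subrK.
by rewrite -{2}(add0n (v : nat)) eqn_modDr mod0n.
Qed.

Lemma orbit_count (x : G) (P : pred G) : x != 0 -> (forall y, P (x + y) = P y) ->
  forall y, P y -> (3 <= \sum_z P z)%N.
Proof.
move=> x0 Px y Py; have x2 : x + x != 0.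
  by apply: contraNneq x0 => xx; rewrite -(G3 x) mulrSr mulr2n xx add0r.
rewrite (bigD1 y) //= (bigD1 (x + y)) /=; last first.
  by rewrite -{2}(add0r y) (inj_eq (addIr y)).
rewrite (bigD1 (x + (x + y))) /= ?Px ?Py //.
rewrite (inj_eq (addrI x)) -{4}(add0r y) !(inj_eq (addIr y)) x0 andbT.
by rewrite addrA -{2}(add0r y) (inj_eq (addIr y)).
Qed.

(** Since [55 f] is [x]-invariant, each value of [55 (f (y + z) - f z)] occurs at least 3 times. A
    coset of prime order [p] other than 5 and 11 keeps [p] distinct values under 55, so the other
    cosets hit each twice more and [3p <= 27] gives [p = 7]. *)
Lemma type_all (x y : G) : x != 0 -> type_5_11_11 x -> y != 0 -> type_5_11_11 y.
Proof.
move=> x0 tx y0; have [s pr_s Es] := fdec y0; have s27 := coset_sum_card Es.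
have F_inv := type_invariant tx.
pose hit c v := (\sum_(h in c.1) ((dlog c.2 + dlog h)%R *+ 55 == v)%R)%N.
have hit_ge3 v : (0 < \sum_(c <- s) hit c v)%N -> (3 <= \sum_(c <- s) hit c v)%N.
  rewrite /hit -(E_sum m_gt1 gen_g ord_g (fun u => u *+ 55 == v)%R Es).
  rewrite lt0n sum_nat_eq0 negb_forall => /existsP[z]; rewrite eqb0 negbK => zv.
  apply: (orbit_count (P := fun z => (f (y + z) - f z) *+ 55 == v) x0 _ zv) => t.
  by rewrite !mulrnBl F_inv [y + _]addrCA F_inv.
pose img c h := (dlog c.2 + dlog h) *+ 55.
have hit_le1 c v : {in c.1 &, injective (img c)} -> (hit c v <= 1)%N.
  move=> inj; have [/exists_inP[k ck /eqP kv]|] := boolP [exists k in c.1, img c k == v].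
    rewrite /hit (bigD1 k) //= -/(img c k) kv eqxx big1 // => h /andP[ch hk].
    by apply/eqP; rewrite eqb0 -kv; apply: contraNneq hk => /inj->.
  rewrite negb_exists_in => /forall_inP nv.
  by rewrite /hit big1 // => h /nv; rewrite /img => /negPf->.
have hit_img c h : {in c.1 &, injective (img c)} -> h \in c.1 -> hit c (img c h) = 1%N.
  move=> inj ch; apply/eqP; rewrite eqn_leq hit_le1 //.
  by rewrite /hit (bigD1 h) //= -/(img c h) eqxx.
have hit_sum c d : {in c.1 &, injective (img c)} ->
    (\sum_(h in c.1) hit d (img c h) <= #|d.1|)%N.
  move=> inj; rewrite /hit exchange_big /= -sum1_card; apply: leq_sum => k _.
  apply: leq_trans (hit_le1 c (img d k) inj).
  by apply: leq_sum => h _; rewrite eq_sym.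
have inj55 c : c \in s -> #|c.1| != 5%N -> #|c.1| != 11%N -> {in c.1 &, injective (img c)}.
  move=> sc n5 n11 h h' ch ch'; rewrite /img !mulrnDl => /addrI hh'.
  apply/eqP; rewrite eq_mulVg1; apply/eqP; apply: (dlog_inj m_gt1 gen_g ord_g).
  rewrite dlog1 //; set k := (h^-1 * h')%g.
  have ck : k \in c.1 by rewrite groupM ?groupV.
  apply: (@mulrn_coprime _ _ 55 #|c.1|); last exact: dlog_card.
    rewrite coprime_sym (coprimeMr #|c.1| 5 11) !prime_coprime ?pr_s //.
    by rewrite !dvdn_prime2 ?pr_s // n5 n11.
  by rewrite /k dlogM // dlogV // mulrnDl mulNrn hh' addNr.
have s_rem c F : c \in s -> (\sum_(d <- s) F d = F c + \sum_(d <- rem c s) F d)%N.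
  by move=> sc; rewrite (perm_big _ (perm_to_rem sc)) big_cons.
(* The values of [c] are distinct, so hitting each [k] more times costs the other cosets weight at
   least [#|c.1| * k]. *)
have extra c k : c \in s -> #|c.1| != 5%N -> #|c.1| != 11%N ->
    (forall v, hit c v = 1 -> k <= \sum_(d <- rem c s) hit d v)%N ->
    (#|c.1| + #|c.1| * k <= 27)%N.
  move=> sc n5 n11 ge_k; have inj := inj55 c sc n5 n11.
  rewrite -s27 (s_rem c (fun d => #|d.1|) sc) leq_add2l -sum_nat_const.
  apply: (@leq_trans (\sum_(h in c.1) \sum_(d <- rem c s) hit d (img c h))).
    by apply: leq_sum => h ch; apply/ge_k/hit_img.
  by rewrite exchange_big /=; apply: leq_sum => d _; apply: hit_sum.
have rem_ge2 c v : c \in s -> hit c v = 1%N -> (2 <= \sum_(d <- rem c s) hit d v)%N.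
  move=> sc cv; have := hit_ge3 v; rewrite (s_rem c (fun d => hit d v) sc) cv.
  exact.
have is7 c : c \in s -> #|c.1| != 5%N -> #|c.1| != 11%N -> #|c.1| = 7%N.
  move=> sc n5 n11; have := extra c 2%N sc n5 n11 (fun v => rem_ge2 c v sc).
  have := prime_coset_ge5 pr_s sc; have := pr_s c sc; move: n5.
  by case: #|_| => [|[|[|[|[|[|[|[|[|[|p]]]]]]]]]] //; lia.
have [/hasP[c sc /eqP c11]|/hasPn no11] := boolP (has (fun c => #|c.1| == 11%N) s).
  exact: type_of_11 pr_s Es sc c11.
(* 27 is not a multiple of 5, so without order 11 some coset has order 7; the others, of weight 20,
   then have order 5. *)
have [all5|] := boolP (all (fun c => #|c.1| == 5%N) s).
  move: s27; rewrite (eq_big_seq (fun=> 5%N)) => [|c /(allP all5)/eqP //].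
  by rewrite big_const_seq iter_addn_0; move: (count _ _); lia.
case/allPn=> c sc n5; have n11 := no11 c sc; have c7 := is7 c sc n5 n11.
have rem20 : sumn [seq #|d.1| | d : {group gT} * gT <- rem c s] = 20%N.
  rewrite sumnE big_map; move: s27; rewrite (s_rem c (fun d => #|d.1|) sc) c7.
  by move=> /eqP; rewrite (eqn_add2l 7 _ 20) => /eqP.
have sub : {subset [seq #|d.1| | d : {group gT} * gT <- rem c s] <= [:: 5; 7; 11]%N}.
  move=> p /mapP[d /mem_rem sd ->]; rewrite !inE.
  have [//|d5] := eqVneq #|d.1| 5%N; have [|d11] := eqVneq #|d.1| 11%N; first by rewrite orbT.
  by rewrite (is7 d sd d5 d11).
have /allP rem5 := sumn_5_7_11 sub rem20.
(* A coset of order 5 hits a value 0 or 5 times, so two further hits become five, and [7 + 7 * 5]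
   exceeds 27. *)
suffices ge5 v : hit c v = 1%N -> (5 <= \sum_(d <- rem c s) hit d v)%N.
  by have := extra c 5%N sc n5 n11 ge5; rewrite c7.
move=> cv; have := rem_ge2 c v sc cv.
rewrite (eq_big_seq (fun d => 5 * (dlog d.2 *+ 55 == v)%R)%N) => [|d rd].
  by rewrite -big_distrr /=; move: (\sum_(d <- _) _)%N; lia.
have d5 : #|d.1| = 5%N by apply/eqP/rem5/map_f.
rewrite /hit -d5 -sum_nat_const; apply: eq_bigr => h dh.
by rewrite mulrnDl (coset_torsion dh) ?d5 // addr0.
Qed.

Lemma no_type_5_11_11 (x : G) : x != 0 -> ~ type_5_11_11 x.
Proof.
move=> x0 tx.
pose n (i : 'I_5) := (\sum_z (f z %% 5 == i))%N.
have rE z (i : 'I_5) : (f z %% 5 == i)%N = (inord (f z %% 5) == i).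
  by rewrite -val_eqE /= inordK ?ltn_mod.
have pick z (F : 'I_5 -> nat) : (\sum_(i < 5) (f z %% 5 == i) * F i = F (inord (f z %% 5)))%N.
  rewrite (bigD1 (inord (f z %% 5))) //= rE eqxx mul1n big1 ?addn0 // => i.
  by rewrite rE eq_sym => /negPf->.
apply: (@no_625_coincidences n).
  rewrite /n exchange_big /= -card_G -sum1_card; apply: eq_bigr => z _.
  by rewrite -[RHS](pick z (fun=> 1%N)); apply: eq_bigr => i _; rewrite muln1.
(* The squares count the pairs of points with equal residue of [f], regrouped by their difference
   [y]: 27 for [y = 0] and 23 for each of the 26 others. *)
transitivity (\sum_y \sum_z (f (y + z)%R %% 5 == f z %% 5))%N.
  rewrite exchange_big /=.
  transitivity (\sum_z n (inord (f z %% 5)))%N.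
    under [RHS]eq_bigr do rewrite -pick.
    by rewrite [RHS]exchange_big /=; apply: eq_bigr => i _; rewrite -big_distrl.
  apply: eq_bigr => z _; rewrite /n (reindex_inj (addIr z)) /=.
  by apply: eq_bigr => y _; rewrite inordK ?ltn_mod.
rewrite (bigD1 0) //= [X in (_ + X)%N](eq_bigr (fun=> 23%N)) => [|y y0]; last first.
  by apply: type_count; apply: type_all tx _.
rewrite (eq_bigr (fun=> 1%N)) => [|z _]; last by rewrite add0r eqxx.
have -> : (\sum_(y : G | y != 0%R) 23 = #|predC1 (0%R : G)| * 23)%N.
  by rewrite -sum_nat_const; apply: eq_bigl => y; rewrite inE.
by rewrite cardC1 sum1_card [#|_|]card_G.
Qed.
End BentCombinatorics.

(** * From bent functions to vanishing sums *)

Lemma flat_transform (G : finZmodType) (c : G -> algC) (n : algC) :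
  (forall chi : 'CF([set: G]), chi \is a linear_char -> \sum_x c x * chi x = n) ->
  forall x, x != 0 -> c x = 0.
Proof.
move=> flat x x0.
have abG : abelian [set: G] by apply/centsP => u _ v _; apply: addrC.
have lin i : 'chi[[set: G]]_i \is a linear_char by apply/char_abelianP.
have orth (u v : G) :
    \sum_i 'chi[[set: G]]_i u * ('chi_i v)^* = #|G|%:R *+ (u == v).
  rewrite second_orthogonality_relation ?inE // (abelian_classP _ abG) ?inE //.
  rewrite (_ : 'C_[set: G][u] = [set: G])%g ?cardsT //.
  by apply/setIidPl/subsetP => v' _; apply/cent1P; apply: addrC.
(* Fourier inversion at [x]: by column orthogonality the sum is [c x] times [#|G|], while the
   constant transform makes it 0. *)
have : \sum_i (\sum_y c y * 'chi[[set: G]]_i y) * ('chi_i x)^* = 0.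
  under eq_bigr do rewrite flat //.
  rewrite -mulr_sumr (eq_bigr (fun i => 'chi[[set: G]]_i 0 * ('chi_i x)^*)) => [|i _].
    by rewrite orth eq_sym (negPf x0) mulr0.
  by rewrite -[0]/(1%g : G) lin_char1 ?mul1r.
under eq_bigr do rewrite mulr_suml.
rewrite exchange_big /= (bigD1 x) //= [X in _ + X]big1 => [|y yx].
  under eq_bigr do rewrite -mulrA.
  rewrite -mulr_sumr orth eqxx addr0 mulr1n => /eqP; rewrite mulf_eq0 pnatr_eq0.
  by rewrite -cardsT -[_ == 0%N]negbK -lt0n cardG_gt0 orbF => /eqP.
under eq_bigr do rewrite -mulrA.
by rewrite -mulr_sumr orth (negPf yx) mulr0.
Qed.
Section PrimitiveRoot.
Variables (gT : finGroupType) (g : gT) (m : nat) (zeta : algC).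
Hypotheses (m_gt1 : (1 < m)%N) (gen_g : generator [set: gT] g)
           (ord_g : #[g]%g = m) (zetaP : m.-primitive_root zeta).
Local Notation dlog := (@dlog gT g m).

(** The faithful character sending [g] to [zeta]. *)
Definition root_char u : algC := zeta ^+ dlog u.
Local Notation phi := root_char.

Lemma prim_exprD_Zp (i j : 'Z_m) : zeta ^+ (i + j)%R = zeta ^+ i * zeta ^+ j.
Proof.
rewrite -[in LHS](natr_Zp i) -[in LHS](natr_Zp j) -natrD val_Zp_nat //.
by rewrite (prim_expr_mod zetaP) exprD.
Qed.

Lemma prim_expr0_Zp : zeta ^+ (0 : 'Z_m)%R = 1.
Proof. by []. Qed.

Lemma prim_exprN_Zp (i : 'Z_m) : zeta ^+ (- i)%R = (zeta ^+ i)^*.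
Proof.
have zi0 : zeta ^+ i != 0 by rewrite expf_neq0 // (prim_root_eq0 zetaP) -lt0n ltnW.
apply: (mulfI zi0); rewrite -prim_exprD_Zp subrr prim_expr0_Zp -normCK.
rewrite normrX (_ : `|zeta| = 1) ?expr1n //.
apply/eqP; rewrite -(pexpr_eq1 (prim_order_gt0 zetaP)) ?normr_ge0 //.
by rewrite -normrX prim_expr_order // normr1.
Qed.

Lemma root_char1 : phi 1%g = 1.
Proof. by rewrite /phi dlog1. Qed.

Lemma root_charM : {morph phi : u v / (u * v)%g >-> u * v}.
Proof. by move=> u v; rewrite /phi dlogM // prim_exprD_Zp. Qed.

Lemma root_char_inj : injective phi.
Proof.
move=> u v /eqP; rewrite (eq_prim_root_expr zetaP) !modn_small ?ltn_Zp //.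
by move/eqP/val_inj/(dlog_inj m_gt1 gen_g ord_g).
Qed.

Lemma root_char_expg i : phi (g ^+ i)%g = zeta ^+ i.
Proof.
rewrite -(expg_natr m_gt1 ord_g) /phi dlog_expg // val_Zp_nat //.
exact: prim_expr_mod.
Qed.

Lemma cyclic_gT : cyclic [set: gT].
Proof. by apply/cyclicP; exists g; apply/eqP. Qed.

Lemma vsumE (X : gT -> nat) :
  \sum_(i < #[g]%g) (X (g ^+ i)%g)%:R * zeta ^+ i = chi_sum phi [set: gT] X.
Proof.
have lt_dlog u : (dlog u < #[g]%g)%N by rewrite ord_g ltn_Zp.
rewrite /chi_sum (reindex (fun i : 'I_#[g]%g => g ^+ i)%g) /=; last first.
  exists (fun u => Ordinal (lt_dlog u)) => [i _|u _]; last by rewrite /= dlogK.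
  apply: val_inj => /=; have i_m : (i < m)%N by rewrite -[ltnRHS]ord_g.
  by rewrite -(expg_natr m_gt1 ord_g) dlog_expg // val_Zp_nat // modn_small.
by apply: eq_big => [i|i _]; rewrite ?inE ?root_char_expg.
Qed.

Lemma chi_sum_E (G : finZmodType) (f : G -> 'Z_m) x :
  chi_sum phi [set: gT] (E_ g f x) = \sum_y zeta ^+ (f (x + y) - f y)%R.
Proof.
have [e Ee de] : exists2 e : G -> gT,
    forall u, E_ g f x u = (\sum_y (u == e y))%N &
    forall y, phi (e y) = zeta ^+ (f (x + y) - f y)%R.
  by exists (fun y => (g ^+ (f (x + y) - f y)%R)%g) => *; [exact: E_at | exact: root_char_expg].
rewrite /chi_sum; under eq_bigr do rewrite Ee natr_sum mulr_suml.
rewrite exchange_big /=; apply: eq_bigr => y _; rewrite -de.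
rewrite (bigD1 (e y)) ?inE //= eqxx mul1r big1 ?addr0 // => u /andP[_ /negPf->].
by rewrite mul0r.
Qed.

(** The squared moduli in the bent condition are the transform of the autocorrelation [c] of
    [zeta ^+ f], and [c x] is the value of [E_x]. *)
Lemma bent_vanishing (G : finZmodType) (f : G -> 'Z_m) :
  generalized_bent zeta f -> forall x, x != 0 ->
  chi_sum phi [set: gT] (E_ g f x) = 0.
Proof.
move=> bent x x0; rewrite chi_sum_E.
under eq_bigr do rewrite prim_exprD_Zp prim_exprN_Zp.
pose c (t : G) := \sum_y zeta ^+ f (t + y) * (zeta ^+ f y)^*.
apply: (@flat_transform G c #|G|%:R) x0.
move=> chi lin_chi; rewrite -(bent chi lin_chi) normCK rmorph_sum /= mulr_suml.
under [RHS]eq_bigr do rewrite mulr_sumr.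
rewrite exchange_big /=; under eq_bigr do rewrite mulr_suml.
rewrite [LHS]exchange_big /=; apply: eq_bigr => y _.
rewrite [RHS](reindex_inj (addIr y)) /=; apply: eq_bigr => t _.
have -> : chi (t + y) = chi t * chi y by rewrite -(lin_charM lin_chi) ?inE.
have chiy : chi y * (chi y)^* = 1 by rewrite -normCK normC_lin_char ?inE ?expr1n.
by rewrite rmorphM /= [RHS]mulrACA -[chi t * _ * _]mulrA chiy mulr1.
Qed.
End PrimitiveRoot.

(** * Minimal vanishing sums and the c-exponent *)

Section MinimalVanishingSums.
Variables (gT : finGroupType) (g : gT) (m : nat) (zeta : algC).
Hypotheses (m_gt1 : (1 < m)%N) (gen_g : generator [set: gT] g)
           (ord_g : #[g]%g = m) (zetaP : m.-primitive_root zeta)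
           (co6 : coprime m 6).
Local Notation phi := (root_char g m zeta).
Implicit Types (c : {group gT} * gT) (X Y : N[gT]).

Definition coset_ind c : N[gT] := [ffun u => (u \in c.2 *: c.1)%g : nat].

Lemma vsumP X : vsum g zeta X <-> chi_sum phi [set: gT] X = 0.
Proof. by rewrite /vsum (vsumE m_gt1 gen_g ord_g zetaP). Qed.

Lemma vsum_prime_cosets X : vsum g zeta X -> (weight [set: gT] X <= 27)%N ->
  exists2 s, prime_cosets s & X =1 coset_sum s.
Proof.
move/vsumP; apply: vanishing_sum_prime_cosets.
- exact: cyclic_gT gen_g.
- exact: root_char1.
- exact: root_charM.
- exact: root_char_inj.
- by rewrite -cardsT (eqP gen_g) -orderE ord_g.
Qed.

Lemma vsum_coset_ind c : prime #|c.1| -> vsum g zeta (coset_ind c).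
Proof.
move=> pr_c; apply/vsumP; rewrite -[RHS](@chi_sum_coset _ phi _ _ _ _ c.1 c.2) //.
- by apply: eq_bigr => u _; rewrite ffunE.
- exact: cyclic_gT gen_g.
- exact: root_char1.
- exact: root_charM.
- exact: root_char_inj.
Qed.

Lemma coset_ind_neq0 c : coset_ind c <> 0.
Proof.
by move/ffunP/(_ c.2); rewrite !ffunE mem_lcoset mulVg group1.
Qed.

Lemma weight_coset_indE c : weight [set: gT] (coset_ind c) = #|c.1|.
Proof.
by rewrite -(weight_coset_ind c.1 c.2); apply: eq_bigr => u _; rewrite ffunE.
Qed.

Lemma coset_sum_ge s c u : c \in s -> (coset_ind c u <= coset_sum s u)%N.
Proof.
move=> sc; rewrite /coset_sum (perm_big _ (perm_to_rem sc)) big_cons ffunE.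
exact: leq_addr.
Qed.

Lemma leq_weight (A : {set gT}) (X Y : gT -> nat) :
  (forall u, X u <= Y u)%N -> (weight A X <= weight A Y)%N.
Proof. by move=> XY; apply: leq_sum. Qed.

(** A coset in the decomposition of [Y] is a vanishing part of [Y], so minimality makes it all of
    [Y]. *)
Lemma minimal_vsum_coset Y :
  minimal_vsum g zeta Y -> (weight [set: gT] Y <= 27)%N ->
  exists2 c : {group gT} * gT, prime #|c.1| & Y = coset_ind c.
Proof.
case=> Y0 vY minY Y27; have [[|c s] pr_s Ys] := vsum_prime_cosets vY Y27.
  by case: Y0; apply/ffunP=> u; rewrite Ys /coset_sum big_nil ffunE.
have pr_c := pr_s c (mem_head _ _); exists c => //.
apply/eqP; apply: contraT => /eqP nY.
case: (minY (coset_ind c)) => //; first exact: coset_ind_neq0.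
- by move=> u; rewrite Ys; apply/coset_sum_ge/mem_head.
- by move/esym.
- exact: vsum_coset_ind.
Qed.

(** A nonzero vanishing part contains a prime coset, whose subgroup lies in that of [c]; both orders
    being prime, the two coincide. *)
Lemma minimal_vsum_coset_ind c :
  prime #|c.1| -> (#|c.1| <= 27)%N -> minimal_vsum g zeta (coset_ind c).
Proof.
move=> pr_c c27; split; first exact: coset_ind_neq0.
  exact: vsum_coset_ind.
move=> Y Y0 Yc nYc vY.
have Y27 : (weight [set: gT] Y <= 27)%N.
  by apply: leq_trans c27; rewrite -weight_coset_indE; apply: leq_weight.
have [[|d s] pr_s Ys] := vsum_prime_cosets vY Y27.
  by case: Y0; apply/ffunP=> u; rewrite Ys /coset_sum big_nil ffunE.
have dY u : (coset_ind d u <= Y u)%N by rewrite Ys; apply/coset_sum_ge/mem_head.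
have dc u : (u \in d.2 *: d.1)%g -> (u \in c.2 *: c.1)%g.
  move=> du; have := leq_trans (dY u) (Yc u); rewrite !ffunE du.
  by case: (u \in _).
have da : (d.2 \in c.2 *: c.1)%g by apply: dc; rewrite mem_lcoset mulVg group1.
have dcE : d.1 = c.1.
  have sub : d.1 \subset c.1.
    apply/subsetP => h dh; have : (d.2 * h \in c.2 *: c.1)%g.
      by apply: dc; rewrite mem_lcoset mulKg.
    by move: da; rewrite !mem_lcoset mulgA => da'; rewrite groupMl.
  apply/val_inj/eqP; rewrite eqEcard sub /=.
  by have := cardSg sub; rewrite dvdn_prime2 ?(pr_s d (mem_head _ _)) // => /eqP->.
case: nYc; apply/ffunP => u; apply/eqP; rewrite eqn_leq Yc /=.
by apply: leq_trans (dY u); rewrite !ffunE dcE (lcoset_eqP da).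
Qed.

(** The quotients of roots in the coset fill [phi] of the subgroup, so a valid [r] kills a
    nontrivial element, whose order is the prime [#|c.1|]. *)
Lemma reduced_exponent_coset c :
  prime #|c.1| -> reduced_exponent g zeta (coset_ind c) = #|c.1|.
Proof.
case: c => H a /= pr_H.
have log u : exists i : 'I_#[g]%g, (g ^+ i)%g = u.
  have := in_setT u.
  by rewrite (eqP gen_g) => /cyclePmin[i lt_i ->]; exists (Ordinal lt_i).
have phiE i : zeta ^+ i = phi (g ^+ i)%g by rewrite root_char_expg.
have phiM := root_charM m_gt1 gen_g ord_g zetaP.
have phi_inj := root_char_inj m_gt1 gen_g ord_g zetaP.
have phi1 := root_char1 zeta m_gt1 gen_g ord_g.
have pos i : (0 < coset_ind (H, a) (g ^+ i)%g)%N = (a^-1 * g ^+ i \in H)%g.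
  by rewrite ffunE mem_lcoset; case: (_ \in _).
have ratio i j k : (zeta ^+ i / zeta ^+ j) ^+ k = phi ((g ^+ j)^-1 * g ^+ i)%g ^+ k.
  congr (_ ^+ _); have phij : phi (g ^+ j)%g != 0 by apply: chi_neq0.
  by apply: (mulfI phij); rewrite !phiE mulrC divfK // -phiM mulKVg.
pose P r := (1 <= r)%N /\
    exists j : 'I_#[g]%g, (0 < coset_ind (H, a) (g ^+ j)%g)%N /\
      forall i : 'I_#[g]%g, (0 < coset_ind (H, a) (g ^+ i)%g)%N ->
        (zeta ^+ i / zeta ^+ j) ^+ r = 1.
have PH : P #|H|.
  have [j gj] := log a; split; first exact: cardG_gt0.
  exists j; rewrite pos gj mulVg group1; split=> // i; rewrite pos => Hi.
  by rewrite ratio gj -chiX // expg_cardG.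
have [[r_gt0 [j [pj rP]]] r_min] := least_natP (ex_intro P _ PH).
rewrite /reduced_exponent -/P; set r := least_nat P in r_gt0 rP r_min *.
apply/eqP; rewrite eqn_leq r_min //=.
have [h Hh h1] : exists2 h, h \in H & h != 1%g.
  by apply/trivgPn; rewrite -cardG_gt1 prime_gt1.
have [i gi] := log (g ^+ j * h)%g; have := rP i.
rewrite ratio !pos gi mulKg mulgA groupMr // -pos pj => /(_ isT).
rewrite -chiX // -phi1 => /phi_inj hr1; apply: dvdn_leq => //.
suffices <- : #[h]%g = #|H| by rewrite order_dvdn hr1.
case/primeP: pr_H => _ /(_ _ (order_dvdG Hh)).
by rewrite order_eq1 (negPf h1) => /eqP.
Qed.

Lemma dvdn_biglcm p (s : seq N[gT]) (F : N[gT] -> nat) :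
  prime p -> (p %| \big[lcmn/1%N]_(Y <- s) F Y)%N ->
  exists2 Y, Y \in s & (p %| F Y)%N.
Proof.
move=> pr_p; elim: s => [|Y s IHs]; first by rewrite big_nil Euclid_dvd1.
rewrite big_cons => pYs.
have : (p %| F Y * \big[lcmn/1%N]_(Z <- s) F Z)%N.
  by apply: dvdn_trans pYs _; rewrite dvdn_lcm dvdn_mulr ?dvdn_mull.
rewrite Euclid_dvdM // => /orP[pY|/IHs[Z sZ pZ]].
  by exists Y; rewrite ?mem_head.
by exists Z; rewrite // inE sZ orbT.
Qed.

(** [p] divides the reduced exponent of a summand [Y] of an optimal decomposition. This [Y] is a
    prime coset, so its order is [p], and the rest of [X] splits into prime cosets again. *)
Lemma c_exponent_prime_coset X p : vsum g zeta X ->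
  (weight [set: gT] X <= 27)%N -> prime p -> (p %| c_exponent g zeta X)%N ->
  exists s c, [/\ prime_cosets s, X =1 coset_sum s, c \in s & #|c.1| = p].
Proof.
move=> vX X27 pr_p.
have [t pr_t Xt] := vsum_prime_cosets vX X27.
have [|[s [min_s Xs] cE] _] := @least_natP (fun k =>
    exists2 s, decomposition g zeta X s &
      k = \big[lcmn/1%N]_(Y <- s) reduced_exponent g zeta Y).
  (* The prime cosets show that a minimum exists, so [c_exponent] is not the default 0, which [p]
     would divide. *)
  exists (\big[lcmn/1%N]_(Y <- map coset_ind t) reduced_exponent g zeta Y).
  exists (map coset_ind t) => //; split.
    move=> Y /mapP[c tc ->]; apply: minimal_vsum_coset_ind; first exact: pr_t.
    rewrite -weight_coset_indE; apply: leq_trans X27; apply: leq_weight => u.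
    by rewrite Xt; apply: coset_sum_ge.
  apply/ffunP => u; rewrite Xt sum_ffunE big_map.
  by apply: eq_bigr => c _; rewrite ffunE.
rewrite /c_exponent cE => /(dvdn_biglcm pr_p)[Y sY pY].
pose Z : N[gT] := \sum_(T <- rem Y s) T.
have XE u : X u = (Y u + Z u)%N.
  by rewrite Xs (perm_big _ (perm_to_rem sY)) big_cons ffunE.
have YX u : (Y u <= X u)%N by rewrite XE leq_addr.
have ZX u : (Z u <= X u)%N by rewrite XE leq_addl.
have Y27 : (weight [set: gT] Y <= 27)%N by apply: leq_trans (leq_weight _ YX) X27.
have Z27 : (weight [set: gT] Z <= 27)%N by apply: leq_trans (leq_weight _ ZX) X27.
have [c pr_c YE] := minimal_vsum_coset (min_s Y sY) Y27.
have vZ : vsum g zeta Z.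
  apply/vsumP; move/vsumP: vX.
  have -> : chi_sum phi [set: gT] X = chi_sum phi [set: gT] (fun u => Y u + Z u)%N.
    by apply: eq_bigr => u _; rewrite XE.
  rewrite chi_sumD => YZ0; have := (vsumP _).1 (vsum_coset_ind pr_c).
  by rewrite -YE => Y0; rewrite Y0 add0r in YZ0.
have [s' pr_s' Zs'] := vsum_prime_cosets vZ Z27.
exists (c :: s'), c; split.
- by move=> d; rewrite inE => /predU1P[-> //|]; apply: pr_s'.
- by move=> u; rewrite XE Zs' YE /coset_sum big_cons ffunE.
- exact: mem_head.
- by move: pY; rewrite YE reduced_exponent_coset // dvdn_prime2 // => /eqP.
Qed.

(** Turns the terms [D_d g^a] of the excluded form into coset indicators. *)
Lemma nmul_nset_nelt (H : {group gT}) a u :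
  nmul (nset H) (nelt a) u = (u \in a *: H)%g.
Proof.
have nsetE v : nset H v = (v \in H).
  rewrite /nset sum_ffunE; under eq_bigr do rewrite ffunE.
  have [Hv|nHv] := boolP (v \in H).
    by rewrite (bigD1 v) //= eqxx big1 ?addr0 // => h /andP[_ /negPf]; rewrite eq_sym => ->.
  by rewrite big1 // => h Hh; case: eqP => // vh; rewrite vh Hh in nHv.
rewrite ffunE (bigD1 (u * a^-1)%g) //= big1 ?addn0 => [|v nv].
  rewrite nsetE ffunE invMg invgK mulgKV eqxx muln1 mem_lcoset.
  by rewrite (centsP (cyclic_abelian (cyclic_gT gen_g)) u _ a^-1%g) ?inE.
rewrite ffunE; case: eqP => [e|]; rewrite ?muln0 //.
by case/eqP: nv; rewrite -e invMg invgK mulKVg.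
Qed.

Lemma nmulDr (X Y Z : N[gT]) u : nmul X (Y + Z) u = (nmul X Y u + nmul X Z u)%N.
Proof.
rewrite !ffunE -big_split /=; apply: eq_bigr => v _.
by rewrite ffunE mulnDr.
Qed.
End MinimalVanishingSums.

(** * Application to the group ['rV['Z_3]_3] of order 27 *)

Theorem proposition3p8 (m' : nat) (m'_gt0 : (0 < m')%N) (m'_odd : odd m')
    (m'_n3 : ~~ (3 %| m')%N) (m'_n5 : ~~ (5 %| m')%N)
    (zeta : algC) (zetaP : (5 * m').-primitive_root zeta)
    (gT : finGroupType) (g : gT)
    (gen_g : generator [set: gT] g) (ord_g : #[g]%g = (5 * m')%N)
    (f : 'rV['Z_3]_3 -> 'Z_(5 * m')) (fP : generalized_bent zeta f) :
  (forall x : 'rV['Z_3]_3, x <> 0 ->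
     forall H5 H11 : {group gT}, #|H5| = 5%N -> #|H11| = 11%N ->
     forall alpha beta gamma : int,
       E_ g f x <> nmul (nset H5) (nelt (expgz g alpha))
                   + nmul (nset H11)
                       (nelt (expgz g beta) + nelt (expgz g gamma)))
  /\ (forall x : 'rV['Z_3]_3, x <> 0 ->
        ~~ (11 %| c_exponent g zeta (E_ g f x))%N).
Proof.
have m_gt1 : (1 < 5 * m')%N by lia.
have co6 : coprime (5 * m') 6.
  rewrite coprimeMl /= (coprimeMr m' 2 3) coprimen2 m'_odd /=.
  by rewrite coprime_sym prime_coprime.
have co5 : coprime 5 m' by rewrite prime_coprime.
have cardV : #|'rV['Z_3]_3| = 27%N by rewrite card_mx card_ord.
have V3 (x : 'rV['Z_3]_3) : x *+ 3 = 0.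
  apply/matrixP => i j; rewrite mulmxnE mxE.
  by rewrite -mulr_natr (_ : 3%:R = 0) ?mulr0 //; apply: val_inj.
have vE x : x != 0 -> vsum g zeta (E_ g f x).
  by move=> x0; apply/(vsumP m_gt1 gen_g ord_g zetaP)/bent_vanishing.
have wE x : (weight [set: gT] (E_ g f x) <= 27)%N.
  rewrite /weight; under eq_bigr do rewrite E_at.
  rewrite exchange_big /= -cardV -sum1_card; apply: leq_sum => y _.
  rewrite (bigD1 (g ^+ (f (x + y) - f y)%R)%g) ?inE // eqxx big1 // => u.
  by case/andP=> _ /negPf->.
have fdec x : x != 0 -> exists2 s, prime_cosets s & E_ g f x =1 coset_sum s.
  by move=> x0; apply: (vsum_prime_cosets m_gt1 gen_g ord_g zetaP co6 (vE x x0) (wE x)).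
have noT x : x != 0 -> ~ type_5_11_11 g f x by apply: no_type_5_11_11.
split=> x /eqP x0.
  move=> H5 H11 c5 c11 a b c Ex; apply: (noT x x0).
  exists (H5, expgz g a), (H11, expgz g b), (H11, expgz g c); split=> // u.
  rewrite Ex ffunE nmulDr !(nmul_nset_nelt gen_g) /coset_sum !big_cons big_nil.
  by rewrite addn0.
apply/negP => c11; apply: (noT x x0).
have [s [c [pr_s Es sc c_11]]] :=
  c_exponent_prime_coset m_gt1 gen_g ord_g zetaP co6 (vE x x0) (wE x) (isT : prime 11) c11.
by apply: type_of_11 pr_s Es sc c_11.
Qed.
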